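(* The category $\mathbb{R}\text{-}\mathrm{Vec}$ has the structure of a codifferential category when equipped with the free $C^\infty$-ring monad $\mathsf{S}^\infty$. Namely, the algebra modality $(S^\infty,\mu,\eta,\mathsf{m},\mathsf{u})$ on $\mathbb{R}\text{-}\mathrm{Vec}$ together with the natural transformation $\mathsf{d}: S^\infty(-)\Rightarrow S^\infty(-)\otimes(-)$ determined by $\mathsf{d}_{\mathbb{R}^n}(f)=\sum_{i=1}^n \frac{\partial f}{\partial x_i}\otimes e_i$ for $f\in C^\infty(\mathbb{R}^n)$, $n\in\mathbb{N}$, is a codifferential category structure.
   Context: Conventions: composition is written in diagrammatic order ($fg$ means first $f$, then $g$); associators and unitors are suppressed; $\sigma$ denotes the symmetry; identity morphisms are denoted $1$. $\mathbb{R}\text{-}\mathrm{Vec}$ is the category of real vector spaces and linear maps with its usual tensor product (unit $k=\mathbb{R}$) and addition of linear maps; it is an additive symmetric monoidal category (symmetric monoidal, enriched in commutative monoids, with $\otimes$ preserving the commutative monoid structure on hom-sets in each variable). Algebra modality on a symmetric monoidal category $\mathcal{C}$: a monad $(S,\mu,\eta)$ with natural transformations $\mathsf{m}_C:SC\otimes SC\to SC$, $\mathsf{u}_C:k\to SC$ such that each $(SC,\mathsf{m}_C,\mathsf{u}_C)$ is a commutative monoid and each $\mu_C$ is a monoid morphism. Deriving transformation: a natural transformation $\mathsf{d}_C:SC\to SC\otimes C$ with [d.1] $\mathsf{u}\mathsf{d}=0$; [d.2] $\mathsf{m}\mathsf{d}=(1\otimes\mathsf{d})(\mathsf{m}\otimes1)+(\mathsf{d}\otimes1)(1\otimes\sigma)(\mathsf{m}\otimes1)$;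 [d.3] $\eta\mathsf{d}=\mathsf{u}\otimes1$; [d.4] $\mu\mathsf{d}=\mathsf{d}(\mu\otimes\mathsf{d})(\mathsf{m}\otimes1)$; [d.5] $\mathsf{d}(\mathsf{d}\otimes1)=\mathsf{d}(\mathsf{d}\otimes1)(1\otimes\sigma)$. A codifferential category is an additive symmetric monoidal category with an algebra modality and a deriving transformation. $C^\infty$-rings: a $C^\infty$-ring $(X,\Phi)$ is a set $X$ with an operation $\Phi_f:X^m\to X$ for each smooth $f:\mathbb{R}^m\to\mathbb{R}$, $m\in\mathbb{N}$, such that $\Phi_{\pi_i}$ is the $i$-th projection and $\Phi_{g\circ\langle f_1,\dots,f_m\rangle}=\Phi_g\circ\langle\Phi_{f_1},\dots,\Phi_{f_m}\rangle$; morphisms preserve all operations. Each $C^\infty$-ring has an underlying commutative $\mathbb{R}$-algebra (from the operations given by polynomials). The forgetful functor from $C^\infty$-rings to $\mathbb{R}\text{-}\mathrm{Vec}$ has a left adjoint; $\mathsf{S}^\infty=(S^\infty,\mu,\eta)$ is the induced monad (it is finitary, i.e. preserves filtered colimits). $\mathsf{m}_V,\mathsf{u}_V$ are the multiplication and unit of the $\mathbb{R}$-algebra underlying the free $C^\infty$-ring $S^\infty(V)$. On finite-dimensional spaces, $S^\infty(\mathbb{R}^n)=C^\infty(\mathbb{R}^n)$ (smooth functions $\mathbb{R}^n\to\mathbb{R}$), with operations $\Phi_g(f_1,\dots,f_m)=g\circ\langle f_1,\dots,f_m\rangle$; $\eta_{\mathbb{R}^n}(e_i)=\pi_i$ (the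 $i$-th projection); and $S^\infty(h)(g)=g\circ h^*$ for linear $h:\mathbb{R}^n\to\mathbb{R}^m$ with transpose $h^*$. Let $\iota:\mathrm{Lin}_{\mathbb{R}}\hookrightarrow\mathbb{R}\text{-}\mathrm{Vec}$ be the full subcategory on the spaces $\mathbb{R}^n$. Finitary functors on $\mathbb{R}\text{-}\mathrm{Vec}$ are exactly the left Kan extensions along $\iota$ of their restrictions to $\mathrm{Lin}_{\mathbb{R}}$, and restriction along $\iota$ is an equivalence between finitary endofunctors of $\mathbb{R}\text{-}\mathrm{Vec}$ and functors $\mathrm{Lin}_{\mathbb{R}}\to\mathbb{R}\text{-}\mathrm{Vec}$. The functors $S^\infty$ and $S^\infty(-)\otimes(-)$ are finitary, and $\mathsf{d}$ is the unique natural transformation $S^\infty(-)\Rightarrow S^\infty(-)\otimes(-)$ whose components at the spaces $\mathbb{R}^n$ are given by the displayed formula, where $e_1,\dots,e_n$ is the standard basis of $\mathbb{R}^n$. *)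

(* Defs.v *)
From HB Require Import structures.
From mathcomp Require Import all_boot all_order all_algebra.
From mathcomp Require Import all_classical all_reals all_analysis.

Set Implicit Arguments.
Unset Strict Implicit.
Unset Printing Implicit Defensive.

Import Order.TTheory GRing.Theory Num.Theory.
Import numFieldNormedType.Exports.
Local Open Scope ring_scope.

(* Composition is diagrammatic: [f >>> g] is first [f], then [g]. *)
Record category := Category {
  ob :> Type;
  hom : ob -> ob -> Type;
  idm : forall a, hom a a;
  comp : forall a b c, hom a b -> hom b c -> hom a c;
  comp1m : forall a b (f : hom a b), comp (idm a) f = f;
  compm1 : forall a b (f : hom a b), comp f (idm b) = f;
  compA : forall a b c e (f : hom a b) (g : hom b c) (h : hom c e),
    comp f (comp g h) = comp (comp f g) h }.

Arguments hom {_} _ _.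
Arguments idm {_} _.
Arguments comp {_ _ _ _} _ _.

Declare Scope cat_scope.
Delimit Scope cat_scope with cat.
Reserved Notation "f >>> g" (at level 40, left associativity).
Reserved Notation "F ;; G" (at level 40, left associativity).
Reserved Notation "a \ox b" (at level 35, right associativity).
Reserved Notation "f \oxm g" (at level 35, right associativity).
Notation "f >>> g" := (comp f g) : cat_scope.
Local Open Scope cat_scope.

Record functor (C D : category) := Functor {
  fob :> C -> D;
  fmap : forall a b, hom a b -> hom (fob a) (fob b);
  fmap1 : forall a, fmap (idm a) = idm (fob a);
  fmapM : forall a b c (f : hom a b) (g : hom b c),
    fmap (f >>> g) = fmap f >>> fmap g }.

Arguments fmap {C D} _ {a b} _.

Definition idF (C : category) : functor C C :=
  @Functor C C id (fun _ _ f => f) (fun _ => erefl) (fun _ _ _ _ _ => erefl).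

Definition constF (C D : category) (x : D) : functor C D :=
  @Functor C D (fun _ => x) (fun _ _ _ => idm x) (fun _ => erefl)
    (fun _ _ _ _ _ => esym (comp1m (idm x))).

Section Composite.
Variables (C D E : category) (F : functor C D) (G : functor D E).

Lemma compF_fmap1 (a : C) : fmap G (fmap F (idm a)) = idm (G (F a)).
Proof. by rewrite !fmap1. Qed.

Lemma compF_fmapM (a b c : C) (f : hom a b) (g : hom b c) :
  fmap G (fmap F (f >>> g)) = fmap G (fmap F f) >>> fmap G (fmap F g).
Proof. by rewrite !fmapM. Qed.

Definition compF : functor C E := Functor compF_fmap1 compF_fmapM.

End Composite.

Notation "F ;; G" := (compF F G) : cat_scope.

Record nattrans (C D : category) (F G : functor C D) := NatTrans {
  ntc :> forall a : C, hom (F a) (G a);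
  naturality : forall (a b : C) (f : hom a b), fmap F f >>> ntc b = ntc a >>> fmap G f }.

Record adjunction (C D : category) (L : functor C D) (U : functor D C) :=
  Adjunction {
  adj_unit : nattrans (idF C) (L ;; U);
  adj_counit : nattrans (U ;; L) (idF D);
  adj_triL : forall a : C, fmap L (adj_unit a) >>> adj_counit (L a) = idm (L a);
  adj_triR : forall x : D, adj_unit (U x) >>> fmap U (adj_counit x) = idm (U x) }.

Section AdjunctionTheory.
Variables (C D : category) (L : functor C D) (U : functor D C).
Variable adj : adjunction L U.

Definition adj_transpose (a : C) (x : D) (h : hom a (U x)) : hom (L a) x :=
  fmap L h >>> adj_counit adj x.

Lemma adj_transposeK (a : C) (x : D) (h : hom a (U x)) :
  adj_unit adj a >>> fmap U (adj_transpose h) = h.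
Proof.
rewrite /adj_transpose fmapM compA.
by rewrite -[X in X >>> _](naturality (adj_unit adj) h) -compA adj_triR compm1.
Qed.

Lemma adj_transposeE (a : C) (x : D) (f : hom (L a) x) :
  f = adj_transpose (adj_unit adj a >>> fmap U f).
Proof.
rewrite /adj_transpose fmapM -compA.
by rewrite [X in _ >>> X](naturality (adj_counit adj) f) compA adj_triL comp1m.
Qed.

Lemma adj_ext (a : C) (x : D) (f g : hom (L a) x) :
  adj_unit adj a >>> fmap U f = adj_unit adj a >>> fmap U g -> f = g.
Proof. by move=> fg; rewrite [LHS]adj_transposeE fg -adj_transposeE. Qed.

End AdjunctionTheory.

Record is_monad (C : category) (S : functor C C)
    (mu : nattrans (S ;; S) S) (eta : nattrans (idF C) S) : Prop := IsMonad {
  monad_unitL : forall a : C, eta (S a) >>> mu a = idm (S a);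
  monad_unitR : forall a : C, fmap S (eta a) >>> mu a = idm (S a);
  monad_assoc : forall a : C, mu (S a) >>> mu a = fmap S (mu a) >>> mu a }.

Section AdjunctionMonad.
Variables (C D : category) (L : functor C D) (U : functor D C).
Variable adj : adjunction L U.

Definition adj_monad : functor C C := L ;; U.

Lemma adj_mu_nat (a b : C) (f : hom a b) :
  fmap (adj_monad ;; adj_monad) f >>> fmap U (adj_counit adj (L b))
  = fmap U (adj_counit adj (L a)) >>> fmap adj_monad f.
Proof. by rewrite /= -!fmapM; congr fmap; exact: (naturality (adj_counit adj)). Qed.

Definition adj_mu : nattrans (adj_monad ;; adj_monad) adj_monad :=
  @NatTrans C C (adj_monad ;; adj_monad) adj_monad
    (fun a => fmap U (adj_counit adj (L a))) adj_mu_nat.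

Definition adj_eta : nattrans (idF C) adj_monad := adj_unit adj.

End AdjunctionMonad.

(* Additive symmetric monoidal categories: [hzero] and [hadd] give the commutative
   monoid structure on hom-sets; [assoV], [lunitV], [runitV] invert the
   associator and the unitors. *)
Record asmc := ASMC {
  asmc_cat :> category;
  hzero : forall a b : asmc_cat, hom a b;
  hadd : forall a b : asmc_cat, hom a b -> hom a b -> hom a b;
  haddA : forall (a b : asmc_cat) (f g h : hom a b),
    hadd f (hadd g h) = hadd (hadd f g) h;
  haddC : forall (a b : asmc_cat) (f g : hom a b), hadd f g = hadd g f;
  hadd0 : forall (a b : asmc_cat) (f : hom a b), hadd (hzero a b) f = f;
  comp0m : forall (a b c : asmc_cat) (f : hom b c), hzero a b >>> f = hzero a c;
  compm0 : forall (a b c : asmc_cat) (f : hom a b), f >>> hzero b c = hzero a c;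
  compDm : forall (a b c : asmc_cat) (f g : hom a b) (h : hom b c),
    hadd f g >>> h = hadd (f >>> h) (g >>> h);
  compmD : forall (a b c : asmc_cat) (f : hom a b) (g h : hom b c),
    f >>> hadd g h = hadd (f >>> g) (f >>> h);
  tob : asmc_cat -> asmc_cat -> asmc_cat;
  tmap : forall a a' b b' : asmc_cat,
    hom a a' -> hom b b' -> hom (tob a b) (tob a' b');
  tmap1 : forall a b : asmc_cat, tmap (idm a) (idm b) = idm (tob a b);
  tmapM : forall (a a' a'' b b' b'' : asmc_cat)
      (f : hom a a') (f' : hom a' a'') (g : hom b b') (g' : hom b' b''),
    tmap (f >>> f') (g >>> g') = tmap f g >>> tmap f' g';
  tmap0m : forall (a a' b b' : asmc_cat) (g : hom b b'),
    tmap (hzero a a') g = hzero (tob a b) (tob a' b');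
  tmapm0 : forall (a a' b b' : asmc_cat) (f : hom a a'),
    tmap f (hzero b b') = hzero (tob a b) (tob a' b');
  tmapDm : forall (a a' b b' : asmc_cat) (f f' : hom a a') (g : hom b b'),
    tmap (hadd f f') g = hadd (tmap f g) (tmap f' g);
  tmapmD : forall (a a' b b' : asmc_cat) (f : hom a a') (g g' : hom b b'),
    tmap f (hadd g g') = hadd (tmap f g) (tmap f g');
  tunit : asmc_cat;
  asso : forall a b c : asmc_cat, hom (tob (tob a b) c) (tob a (tob b c));
  assoV : forall a b c : asmc_cat, hom (tob a (tob b c)) (tob (tob a b) c);
  lunit : forall a : asmc_cat, hom (tob tunit a) a;
  lunitV : forall a : asmc_cat, hom a (tob tunit a);
  runit : forall a : asmc_cat, hom (tob a tunit) a;
  runitV : forall a : asmc_cat, hom a (tob a tunit);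
  sym : forall a b : asmc_cat, hom (tob a b) (tob b a);
  assoK : forall a b c : asmc_cat, asso a b c >>> assoV a b c = idm _;
  assoVK : forall a b c : asmc_cat, assoV a b c >>> asso a b c = idm _;
  lunitK : forall a : asmc_cat, lunit a >>> lunitV a = idm _;
  lunitVK : forall a : asmc_cat, lunitV a >>> lunit a = idm _;
  runitK : forall a : asmc_cat, runit a >>> runitV a = idm _;
  runitVK : forall a : asmc_cat, runitV a >>> runit a = idm _;
  symK : forall a b : asmc_cat, sym a b >>> sym b a = idm _;
  asso_nat : forall (a a' b b' c c' : asmc_cat)
      (f : hom a a') (g : hom b b') (h : hom c c'),
    tmap (tmap f g) h >>> asso a' b' c' = asso a b c >>> tmap f (tmap g h);
  lunit_nat : forall (a b : asmc_cat) (f : hom a b),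
    tmap (idm tunit) f >>> lunit b = lunit a >>> f;
  runit_nat : forall (a b : asmc_cat) (f : hom a b),
    tmap f (idm tunit) >>> runit b = runit a >>> f;
  sym_nat : forall (a a' b b' : asmc_cat) (f : hom a a') (g : hom b b'),
    tmap f g >>> sym a' b' = sym a b >>> tmap g f;
  triangle : forall a b : asmc_cat,
    asso a tunit b >>> tmap (idm a) (lunit b) = tmap (runit a) (idm b);
  pentagon : forall a b c e : asmc_cat,
    tmap (asso a b c) (idm e) >>> asso a (tob b c) e
      >>> tmap (idm a) (asso b c e)
    = asso (tob a b) c e >>> asso a b (tob c e);
  hexagon : forall a b c : asmc_cat,
    asso a b c >>> sym a (tob b c) >>> asso b c a
    = tmap (sym a b) (idm c) >>> asso b a c >>> tmap (idm b) (sym a c) }.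

Arguments hzero {_ _ _}.
Arguments hadd {_ _ _} _ _.
Arguments tob {_} _ _.
Arguments tmap {_ _ _ _ _} _ _.
Arguments tunit {_}.
Arguments asso {_} _ _ _.
Arguments assoV {_} _ _ _.
Arguments lunit {_} _.
Arguments lunitV {_} _.
Arguments runit {_} _.
Arguments runitV {_} _.
Arguments sym {_} _ _.

Notation "a \ox b" := (tob a b) : cat_scope.
Notation "f \oxm g" := (tmap f g) : cat_scope.

Section TensorFunctor.
Variables (C : category) (M : asmc) (F G : functor C M).

Lemma tensF_fmap1 (a : C) :
  fmap F (idm a) \oxm fmap G (idm a) = idm (F a \ox G a).
Proof. by rewrite !fmap1 tmap1. Qed.

Lemma tensF_fmapM (a b c : C) (f : hom a b) (g : hom b c) :
  fmap F (f >>> g) \oxm fmap G (f >>> g)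
  = (fmap F f \oxm fmap G f) >>> (fmap F g \oxm fmap G g).
Proof. by rewrite !fmapM tmapM. Qed.

Definition tensF : functor C M := Functor tensF_fmap1 tensF_fmapM.

End TensorFunctor.

Section Codifferential.
Variable C : asmc.

Record is_com_monoid (a : C) (m : hom (a \ox a) a) (u : hom tunit a) : Prop :=
  IsComMonoid {
  cmon_assoc : (m \oxm idm a) >>> m = asso a a a >>> (idm a \oxm m) >>> m;
  cmon_unitL : (u \oxm idm a) >>> m = lunit a;
  cmon_unitR : (idm a \oxm u) >>> m = runit a;
  cmon_comm : sym a a >>> m = m }.

Record is_monoid_morphism (a b : C) (ma : hom (a \ox a) a) (ua : hom tunit a)
    (mb : hom (b \ox b) b) (ub : hom tunit b) (f : hom a b) : Prop :=
  IsMonoidMorphism {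
  monmor_mul : ma >>> f = (f \oxm f) >>> mb;
  monmor_unit : ua >>> f = ub }.

Variables (S : functor C C) (mu : nattrans (S ;; S) S) (eta : nattrans (idF C) S).
Variables (m : nattrans (tensF S S) S) (u : nattrans (constF C tunit) S).

Record is_algebra_modality : Prop := IsAlgebraModality {
  am_monad : is_monad mu eta;
  am_monoid : forall a : C, @is_com_monoid (S a) (m a) (u a);
  am_mu : forall a : C,
    @is_monoid_morphism (S (S a)) (S a) (m (S a)) (u (S a)) (m a) (u a) (mu a) }.

Variable d : nattrans S (tensF S (idF C)).

(* The associators and unitors that diagrams of maps between tensor products
   usually leave out are inserted. *)
Record is_deriving : Prop := IsDeriving {
  deriving_const : forall a : C, u a >>> d a = hzero;
  deriving_Leibniz : forall a : C,
    m a >>> d a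
    = hadd ((idm (S a) \oxm d a) >>> assoV (S a) (S a) a >>> (m a \oxm idm a))
           ((d a \oxm idm (S a)) >>> asso (S a) a (S a)
              >>> (idm (S a) \oxm sym a (S a)) >>> assoV (S a) (S a) a
              >>> (m a \oxm idm a));
  deriving_linear : forall a : C,
    eta a >>> d a = lunitV a >>> (u a \oxm idm a);
  deriving_chain : forall a : C,
    mu a >>> d a
    = d (S a) >>> (mu a \oxm d a) >>> assoV (S a) (S a) a >>> (m a \oxm idm a);
  deriving_sym : forall a : C,
    d a >>> (d a \oxm idm a)
    = d a >>> (d a \oxm idm a)
        >>> asso (S a) a a >>> (idm (S a) \oxm sym a a) >>> assoV (S a) a a }.

Definition is_codifferential : Prop := is_algebra_modality /\ is_deriving.

End Codifferential.

Section Smooth.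
Variable R : realType.

Definition partial n (i : 'I_n) (f : 'rV[R]_n -> R) : 'rV[R]_n -> R :=
  fun x => 'D_(delta_mx 0 i) f x.

Definition iter_partial n (s : seq 'I_n) (f : 'rV[R]_n -> R) : 'rV[R]_n -> R :=
  foldl (fun g i => partial i g) f s.

(* All iterated partial derivatives of [f], of all orders (including 0), are
   differentiable, hence continuous, everywhere. *)
Definition is_smooth n (f : 'rV[R]_n -> R) : Prop :=
  forall (s : seq 'I_n) x, differentiable (iter_partial s f) x.

Record smooth n := Smooth {
  sfun :> 'rV[R]_n -> R;
  smoothP : is_smooth sfun }.

Lemma smooth_eq n (f g : smooth n) : f =1 g -> f = g.
Proof.
case: f g => [f fP] [g gP] /= /funext fg; rewrite fg in fP *.
by congr Smooth; exact: Prop_irrelevance.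
Qed.

HB.instance Definition _ n := gen_eqMixin (smooth n).
HB.instance Definition _ n := gen_choiceMixin (smooth n).

Lemma is_smoothW n (P : ('rV[R]_n -> R) -> Prop) :
  (forall f x, P f -> differentiable f x) ->
  (forall f i, P f -> P (partial i f)) ->
  forall f, P f -> is_smooth f.
Proof.
move=> dP pP f Pf s; elim: s f Pf => [|i s IHs] f Pf x; first exact: dP.
exact/IHs/pP.
Qed.

Lemma is_smooth_diff n (f : 'rV[R]_n -> R) x : is_smooth f -> differentiable f x.
Proof. by move=> /(_ [::] x). Qed.

Lemma is_smooth_partial n (f : 'rV[R]_n -> R) i :
  is_smooth f -> is_smooth (partial i f).
Proof. by move=> fs s; exact: (fs (i :: s)). Qed.

Definition rowf m n (f : 'I_m -> 'rV[R]_n -> R) (x : 'rV[R]_n) : 'rV[R]_m :=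
  \row_j f j x.

Lemma differentiable_rowf m n (f : 'I_m -> 'rV[R]_n -> R) x :
  (forall j, differentiable (f j) x) -> differentiable (rowf f) x.
Proof.
move=> df.
have -> : rowf f = \sum_(j < m) (fun y => f j y *: (delta_mx 0 j : 'rV[R]_m)).
  apply/funext => y; rewrite fct_sumE [LHS]row_sum_delta.
  by apply: eq_bigr => j _; rewrite mxE.
by apply: differentiable_sum => j; exact: differentiableZl.
Qed.

Lemma partial_comp m n (g : 'rV[R]_m -> R) (f : 'I_m -> 'rV[R]_n -> R) i x :
  differentiable g (rowf f x) -> (forall j, differentiable (f j) x) ->
  partial i (g \o rowf f) x
  = \sum_j partial j g (rowf f x) * partial i (f j) x.
Proof.
move=> dg df; have dF := differentiable_rowf df.
rewrite /partial deriveE; last exact: differentiable_comp.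
rewrite diff_comp //=; set v := delta_mx 0 i.
rewrite [X in 'd g _ X]row_sum_delta linear_sum; apply: eq_bigr => j _.
rewrite linearZ /= mulrC; congr (_ * _); last by rewrite deriveE.
rewrite [RHS]deriveE //.
pose c := fun y : 'rV[R]_m => y 0 j : R.
have dc y : differentiable c y by exact: differentiable_coord.
have -> : f j = c \o rowf f by apply/funext => y; rewrite /c /= mxE.
rewrite diff_comp //=.
have @cl : {linear 'rV[R]_m -> R}.
  by exists c; do 2![eexists]; do ?[constructor]; rewrite /c ?mxE// => ? *;
     rewrite ?mxE//; move=> ?; rewrite !mxE.
have -> : c = cl by [].
rewrite diff_lin //.
by move=> y; exact: (@coord_continuous R 1 m 0 j y).
Qed.

Lemma partialD n (f g : 'rV[R]_n -> R) i :
  (forall x, differentiable f x) -> (forall x, differentiable g x) ->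
  partial i (fun x => f x + g x) = (fun x => partial i f x + partial i g x).
Proof.
move=> df dg; apply/funext => x; rewrite /partial.
by apply: deriveD; exact: diff_derivable.
Qed.

Lemma partialM n (f g : 'rV[R]_n -> R) i :
  (forall x, differentiable f x) -> (forall x, differentiable g x) ->
  partial i (fun x => f x * g x)
  = (fun x => f x * partial i g x + g x * partial i f x).
Proof.
move=> df dg; apply/funext => x; rewrite /partial.
by apply: deriveM; exact: diff_derivable.
Qed.

Inductive smooth_closure n : ('rV[R]_n -> R) -> Prop :=
| SCbase f of is_smooth f : smooth_closure f
| SCadd f g of smooth_closure f & smooth_closure g :
    smooth_closure (fun x => f x + g x)
| SCmul f g of smooth_closure f & smooth_closure g :
    smooth_closure (fun x => f x * g x)
| SCcomp m (g : 'rV[R]_m -> R) (f : 'I_m -> 'rV[R]_n -> R)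
    of is_smooth g & (forall j, is_smooth (f j)) :
    smooth_closure (g \o rowf f).

Lemma is_smooth_cst n (c : R) : is_smooth (fun _ : 'rV[R]_n => c).
Proof.
apply: (@is_smoothW _ (fun f => exists c, f = cst c)); last by exists c.
- by move=> f x [{}c ->]; exact: differentiable_cst.
- move=> f i [{}c ->]; exists 0; apply/funext => x.
  by rewrite /partial derive_cst.
Qed.

Lemma smooth_closureP n (f : 'rV[R]_n -> R) : smooth_closure f -> is_smooth f.
Proof.
have dS (h : 'rV[R]_n -> R) : smooth_closure h -> forall x, differentiable h x.
  elim=> [{}h hs x|h1 h2 _ d1 _ d2 x|h1 h2 _ d1 _ d2 x|m g F gs Fs x].
  - exact: is_smooth_diff.
  - exact: differentiableD.
  - exact: differentiableM.
  - apply: differentiable_comp; last exact: is_smooth_diff.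
    by apply: differentiable_rowf => j; exact: is_smooth_diff.
move: f; apply: is_smoothW => [h x|h i]; first by move/dS.
elim=> [{}h hs|h1 h2 s1 p1 s2 p2|h1 h2 s1 p1 s2 p2|m g F gs Fs].
- exact/SCbase/is_smooth_partial.
- by rewrite partialD; [exact: SCadd|exact: dS|exact: dS].
- rewrite partialM; [|exact: dS|exact: dS].
  by apply: SCadd; exact: SCmul.
- have -> : partial i (g \o rowf F)
      = (fun x => \sum_(j <- index_enum _)
                    (partial j g \o rowf F) x * partial i (F j) x).
    apply/funext => x; rewrite partial_comp //; first exact: is_smooth_diff.
    by move=> j; exact: is_smooth_diff.
  elim: (index_enum _) => [|j s IHs].
    under eq_fun do rewrite big_nil.
    exact/SCbase/is_smooth_cst.
  under eq_fun do rewrite big_cons.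
  apply: SCadd => //; apply: SCmul.
    by apply: SCcomp => //; exact: is_smooth_partial.
  exact/SCbase/is_smooth_partial.
Qed.

Lemma is_smooth_coord n (i : 'I_n) : is_smooth (fun x : 'rV[R]_n => x 0 i).
Proof.
pose P (f : 'rV[R]_n -> R) := is_smooth f \/ f = (fun x => x 0 i).
apply: (@is_smoothW _ P); last by right.
- by move=> f x [fs|->]; [exact: is_smooth_diff|exact: differentiable_coord].
- move=> f j [fs|->]; left; first exact: is_smooth_partial.
  suff -> : partial j (fun x : 'rV[R]_n => x 0 i)
            = cst ((delta_mx 0 j : 'rV[R]_n) 0 i).
    exact: is_smooth_cst.
  apply/funext => x; rewrite /partial deriveE; last exact: differentiable_coord.
  have @cl : {linear 'rV[R]_n -> R}.
    by exists (fun y : 'rV[R]_n => y 0 i); do 2![eexists]; do ?[constructor];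
       rewrite ?mxE// => ? *; rewrite ?mxE//; move=> ?; rewrite !mxE.
  rewrite (_ : (fun y : 'rV[R]_n => y 0 i) = cl) // diff_lin //.
  by move=> y; exact: (@coord_continuous R 1 n 0 i y).
Qed.

Definition scst n (c : R) : smooth n := Smooth (@is_smooth_cst n c).

Definition sproj n (i : 'I_n) : smooth n := Smooth (@is_smooth_coord n i).

Definition sadd n (f g : smooth n) : smooth n :=
  Smooth (smooth_closureP (SCadd (SCbase (smoothP f)) (SCbase (smoothP g)))).

Definition smul n (f g : smooth n) : smooth n :=
  Smooth (smooth_closureP (SCmul (SCbase (smoothP f)) (SCbase (smoothP g)))).

(* [scomp g f] is [g \o <f_1, ..., f_m>]. *)
Definition scomp m n (g : smooth m) (f : 'I_m -> smooth n) : smooth n :=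
  Smooth (smooth_closureP (SCcomp (smoothP g) (fun j => smoothP (f j)))).

Definition spartial n (i : 'I_n) (f : smooth n) : smooth n :=
  Smooth (is_smooth_partial i (smoothP f)).

End Smooth.

Section MkLinear.
Variables (R : realType) (V W : lmodType R) (f : V -> W) (fl : linear f).

Definition mklin_fun := f.
HB.instance Definition _ := GRing.isLinear.Build R V W *:%R mklin_fun fl.
Definition mklin : {linear V -> W} := mklin_fun.

End MkLinear.
Arguments mklin : simpl never.

Lemma lin_eq (R : realType) (V W : lmodType R) (f g : {linear V -> W}) :
  f =1 g -> f = g.
Proof.
case: f g => [f [[fP1] [fP2]]] [g [[gP1] [gP2]]] /= /funext fg.
move: fP1 fP2 gP1 gP2; rewrite fg => *.
congr (GRing.Linear.Pack (GRing.Linear.Class _ _)).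
- by congr (Algebra.isNmodMorphism.Axioms_ _); exact: Prop_irrelevance.
- by congr (GRing.isScalable.Axioms_ _ _); exact: Prop_irrelevance.
Qed.

Section Tensor.
Variables (R : realType) (V W : lmodType R).

Definition bilin (U : lmodType R) (f : V -> W -> U) : Prop :=
  (forall w, linear (f^~ w)) /\ (forall v, linear (f v)).

Definition tens_eval (U : lmodType R) (f : V -> W -> U) (s : seq (V * W)) : U :=
  \sum_(p <- s) f p.1 p.2.

(* A list [(v_1, w_1); ...; (v_n, w_n)] stands for the formal sum of the
   v_i \ox w_i; two formal sums are identified when no bilinear map separates
   them, which is the universal property of the tensor product. *)
Definition tens_rel (s t : seq (V * W)) : bool :=
  `[< forall (U : lmodType R) (f : V -> W -> U),
        bilin f -> tens_eval f s = tens_eval f t >].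

Lemma tens_rel_refl : reflexive tens_rel.
Proof. by move=> s; apply/asboolP. Qed.

Lemma tens_rel_sym : symmetric tens_rel.
Proof.
by move=> s t; apply/asboolP/asboolP => st U f /st.
Qed.

Lemma tens_rel_trans : transitive tens_rel.
Proof.
move=> t s r /asboolP st /asboolP tr; apply/asboolP => U f fb.
by rewrite st // tr.
Qed.

Canonical tens_equiv :=
  EquivRel tens_rel tens_rel_refl tens_rel_sym tens_rel_trans.

Definition tens := {eq_quot tens_equiv}%qT.
HB.instance Definition _ := Choice.on tens.

Definition tens_mk (s : seq (V * W)) : tens := (\pi_tens s)%qT.

Definition pure (v : V) (w : W) : tens := tens_mk [:: (v, w)].

Definition tens_lift_fun (U : lmodType R) (f : V -> W -> U) (x : tens) : U :=
  tens_eval f (repr x).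

Lemma tens_lift_mk (U : lmodType R) (f : V -> W -> U) (s : seq (V * W)) :
  bilin f -> tens_lift_fun f (tens_mk s) = tens_eval f s.
Proof.
move=> fb; have /eqmodP/asboolP : (repr (tens_mk s) = s %[mod_eq tens_equiv])%qT.
  by rewrite reprK.
exact.
Qed.

Lemma tens_sep (x y : tens) :
  (forall (U : lmodType R) (f : V -> W -> U),
     bilin f -> tens_lift_fun f x = tens_lift_fun f y) -> x = y.
Proof.
move=> xy; rewrite -[x]reprK -[y]reprK; apply/eqmodP/asboolP => U f fb.
exact: xy.
Qed.

Definition tens0 : tens := tens_mk [::].
Definition tens_add (x y : tens) : tens := tens_mk (repr x ++ repr y).
Definition tens_scale (c : R) (x : tens) : tens :=
  tens_mk [seq (c *: p.1, p.2) | p <- repr x].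

Section Lift.
Variables (U : lmodType R) (f : V -> W -> U) (fb : bilin f).

Let fl (w : W) : linear (f^~ w) := proj1 fb w.
Let fr (v : V) : linear (f v) := proj2 fb v.

Lemma tens_lift0 : tens_lift_fun f tens0 = 0.
Proof. by rewrite tens_lift_mk // /tens_eval big_nil. Qed.

Lemma tens_liftD (x y : tens) :
  tens_lift_fun f (tens_add x y) = tens_lift_fun f x + tens_lift_fun f y.
Proof. by rewrite tens_lift_mk // /tens_eval big_cat. Qed.

Lemma tens_liftZ (c : R) (x : tens) :
  tens_lift_fun f (tens_scale c x) = c *: tens_lift_fun f x.
Proof.
rewrite tens_lift_mk // /tens_eval big_map scaler_sumr; apply: eq_bigr => p _.
exact: (linearZZ (mklin (fl p.2)) c p.1).
Qed.

Lemma tens_lift_pure (v : V) (w : W) : tens_lift_fun f (pure v w) = f v w.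
Proof. by rewrite tens_lift_mk // /tens_eval big_seq1. Qed.

End Lift.

Definition tens_opp := tens_scale (-1).

Lemma tens_addA : associative tens_add.
Proof. by move=> x y z; apply: tens_sep => U f fb; rewrite !tens_liftD // addrA. Qed.

Lemma tens_addC : commutative tens_add.
Proof. by move=> x y; apply: tens_sep => U f fb; rewrite !tens_liftD // addrC. Qed.

Lemma tens_add0 : left_id tens0 tens_add.
Proof.
by move=> x; apply: tens_sep => U f fb; rewrite tens_liftD // tens_lift0 // add0r.
Qed.

Lemma tens_addN : left_inverse tens0 tens_opp tens_add.
Proof.
move=> x; apply: tens_sep => U f fb.
by rewrite tens_liftD // tens_liftZ // tens_lift0 // scaleN1r addNr.
Qed.

HB.instance Definition _ :=
  GRing.isZmodule.Build tens tens_addA tens_addC tens_add0 tens_addN.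

Lemma tens_scaleA (a b : R) (x : tens) :
  tens_scale a (tens_scale b x) = tens_scale (a * b) x.
Proof. by apply: tens_sep => U f fb; rewrite !tens_liftZ // scalerA. Qed.

Lemma tens_scale1 : left_id 1 tens_scale.
Proof. by move=> x; apply: tens_sep => U f fb; rewrite tens_liftZ // scale1r. Qed.

Lemma tens_scaleDr : right_distributive tens_scale +%R.
Proof.
move=> c x y; apply: tens_sep => U f fb.
by rewrite [LHS]tens_liftZ // !tens_liftD // scalerDr !tens_liftZ.
Qed.

Lemma tens_scaleDl (x : tens) : {morph tens_scale^~ x : a b / a + b}.
Proof.
move=> a b; apply: tens_sep => U f fb.
by rewrite [LHS]tens_liftZ // tens_liftD // scalerDl !tens_liftZ.
Qed.

HB.instance Definition _ := GRing.Zmodule_isLmodule.Build R tens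
  tens_scaleA tens_scale1 tens_scaleDr tens_scaleDl.

Lemma tens_lift_linear (U : lmodType R) (f : V -> W -> U) (fb : bilin f) :
  linear (tens_lift_fun f).
Proof. by move=> c x y; rewrite [LHS]tens_liftD // tens_liftZ. Qed.

Definition tens_lift (U : lmodType R) (f : V -> W -> U) (fb : bilin f) :
  {linear tens -> U} := mklin (tens_lift_linear fb).
Arguments tens_lift : simpl never.

Lemma tens_liftE (U : lmodType R) (f : V -> W -> U) (fb : bilin f) v w :
  tens_lift fb (pure v w) = f v w.
Proof. exact: tens_lift_pure. Qed.

Lemma pure_bilin : bilin pure.
Proof.
split=> [w|v] c x y; apply: tens_sep => U f fb;
  rewrite [RHS]tens_liftD // tens_liftZ // !tens_lift_pure //.
- exact: (proj1 fb w c x y).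
- exact: (proj2 fb v c x y).
Qed.

Lemma tens_sum (x : tens) : x = \sum_(p <- repr x) pure p.1 p.2.
Proof.
apply: tens_sep => U f fb; rewrite -[RHS]/(tens_lift fb _) linear_sum.
by apply: eq_bigr => p _; rewrite tens_liftE.
Qed.

Lemma tens_ind (P : tens -> Prop) :
  P 0 -> (forall x y, P x -> P y -> P (x + y)) -> (forall v w, P (pure v w)) ->
  forall x, P x.
Proof.
move=> P0 PD Pp x; rewrite (tens_sum x).
by elim: (repr x) => [|p s IHs]; rewrite ?big_nil ?big_cons //; exact: PD.
Qed.

Lemma pureDl (v v' : V) (w : W) : pure (v + v') w = pure v w + pure v' w.
Proof. by have /= := proj1 pure_bilin w 1 v v'; rewrite !scale1r. Qed.

Lemma pureDr (v : V) (w w' : W) : pure v (w + w') = pure v w + pure v w'.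
Proof. by have /= := proj2 pure_bilin v 1 w w'; rewrite !scale1r. Qed.

Lemma pure0l (w : W) : pure 0 w = 0.
Proof. exact: (linear0 (mklin (proj1 pure_bilin w))). Qed.

Lemma pure0r (v : V) : pure v 0 = 0.
Proof. exact: (linear0 (mklin (proj2 pure_bilin v))). Qed.

Lemma pureZl c (v : V) (w : W) : pure (c *: v) w = c *: pure v w.
Proof. exact: (linearZZ (mklin (proj1 pure_bilin w))). Qed.

Lemma pureZr c (v : V) (w : W) : pure v (c *: w) = c *: pure v w.
Proof. exact: (linearZZ (mklin (proj2 pure_bilin v))). Qed.

Lemma tens_ext (U : lmodType R) (f g : {linear tens -> U}) :
  (forall v w, f (pure v w) = g (pure v w)) -> f = g.
Proof.
move=> fg; apply: lin_eq; apply: tens_ind => [|x y fx fy|//].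
- by rewrite !linear0.
- by rewrite !linearD fx fy.
Qed.

End Tensor.

Section TensorExt.
Variable R : realType.

Lemma tens_ext3l (A B C U : lmodType R) (f g : {linear tens (tens A B) C -> U}) :
  (forall a b c, f (pure (pure a b) c) = g (pure (pure a b) c)) -> f = g.
Proof.
move=> fg; apply: tens_ext => x c; move: x; apply: tens_ind => [|x y fx fy|//].
- by rewrite pure0l !linear0.
- by rewrite pureDl !linearD fx fy.
Qed.

Lemma tens_ext3r (A B C U : lmodType R) (f g : {linear tens A (tens B C) -> U}) :
  (forall a b c, f (pure a (pure b c)) = g (pure a (pure b c))) -> f = g.
Proof.
move=> fg; apply: tens_ext => a x; move: x; apply: tens_ind => [|x y fx fy|//].
- by rewrite pure0r !linear0.
- by rewrite pureDr !linearD fx fy.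
Qed.

Lemma tens_ext4 (A B C D U : lmodType R)
    (f g : {linear tens (tens (tens A B) C) D -> U}) :
  (forall a b c d, f (pure (pure (pure a b) c) d)
                 = g (pure (pure (pure a b) c) d)) -> f = g.
Proof.
move=> fg; apply: tens_ext3l => x c d; move: x; apply: tens_ind => [|x y fx fy|//].
- by rewrite !pure0l !linear0.
- by rewrite !pureDl !linearD fx fy.
Qed.

End TensorExt.

Arguments tens_lift : simpl never.

Section RVec.
Variable R : realType.
Implicit Types U V W X : lmodType R.

Definition lin_id V : {linear V -> V} := idfun.

Definition lin_comp U V W (f : {linear U -> V}) (g : {linear V -> W}) :
  {linear U -> W} := g \o f.

Definition lin_zero V W : {linear V -> W} := \0.

Definition lin_add V W (f g : {linear V -> W}) : {linear V -> W} := f \+ g.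

Lemma lin_comp1m V W (f : {linear V -> W}) : lin_comp (lin_id V) f = f.
Proof. exact: lin_eq. Qed.

Lemma lin_compm1 V W (f : {linear V -> W}) : lin_comp f (lin_id W) = f.
Proof. exact: lin_eq. Qed.

Lemma lin_compA U V W X (f : {linear U -> V}) (g : {linear V -> W})
    (h : {linear W -> X}) :
  lin_comp f (lin_comp g h) = lin_comp (lin_comp f g) h.
Proof. exact: lin_eq. Qed.

Definition rvec_cat : category := Category lin_comp1m lin_compm1 lin_compA.

Section Maps.
Variables V V' W W' : lmodType R.

Lemma tens_map_bilin (f : {linear V -> V'}) (g : {linear W -> W'}) :
  bilin (fun v w => pure (f v) (g w)).
Proof.
by split=> [w|v] c x y /=; rewrite linearP ?(pureDl, pureDr) ?(pureZl, pureZr).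
Qed.

Definition tens_map (f : {linear V -> V'}) (g : {linear W -> W'}) :
  {linear tens V W -> tens V' W'} := tens_lift (tens_map_bilin f g).

Lemma tens_mapE f g v w : tens_map f g (pure v w) = pure (f v) (g w).
Proof. exact: tens_liftE. Qed.

Lemma tens_sym_bilin : bilin (fun (v : V) (w : W) => pure w v).
Proof.
by split=> [w|v] c x y /=; rewrite ?(pureDl, pureDr) ?(pureZl, pureZr).
Qed.

Definition tens_sym : {linear tens V W -> tens W V} := tens_lift tens_sym_bilin.

Lemma tens_symE v w : tens_sym (pure v w) = pure w v.
Proof. exact: tens_liftE. Qed.

End Maps.

Section Asso.
Variables A B C : lmodType R.

Lemma asso_bilin1 (c : C) : bilin (fun (a : A) (b : B) => pure a (pure b c)).
Proof.
by split=> [b|a] k x y /=; rewrite ?(pureDl, pureDr) ?(pureZl, pureZr).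
Qed.

Lemma asso_bilin : bilin (fun (x : tens A B) (c : C) => tens_lift (asso_bilin1 c) x).
Proof.
split=> [c|x] k y z; first by rewrite linearP.
move: x; apply: tens_ind => [|x x' IHx IHx'|a b].
- by rewrite !linear0 addr0.
- by rewrite !linearD IHx IHx' addrACA.
- by rewrite !tens_liftE /= !pureDr !pureZr.
Qed.

Definition tens_asso : {linear tens (tens A B) C -> tens A (tens B C)} :=
  tens_lift asso_bilin.

Lemma tens_assoE a b c : tens_asso (pure (pure a b) c) = pure a (pure b c).
Proof. by rewrite !tens_liftE. Qed.

Lemma assoV_bilin1 (a : A) : bilin (fun (b : B) (c : C) => pure (pure a b) c).
Proof.
by split=> [c|b] k x y /=; rewrite ?(pureDl, pureDr) ?(pureZl, pureZr) ?pureDl ?pureZl.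
Qed.

Lemma assoV_bilin : bilin (fun (a : A) (x : tens B C) => tens_lift (assoV_bilin1 a) x).
Proof.
split=> [x|a] k y z; last by rewrite linearP.
move: x; apply: tens_ind => [|x x' IHx IHx'|b c].
- by rewrite !linear0 addr0.
- by rewrite !linearD IHx IHx' addrACA.
- by rewrite !tens_liftE /= !pureDl !pureZl.
Qed.

Definition tens_assoV : {linear tens A (tens B C) -> tens (tens A B) C} :=
  tens_lift assoV_bilin.

Lemma tens_assoVE a b c : tens_assoV (pure a (pure b c)) = pure (pure a b) c.
Proof. by rewrite !tens_liftE. Qed.

End Asso.

Section Unitors.
Variable V : lmodType R.

Lemma lunit_bilin : bilin (fun (c : R^o) (v : V) => c *: v).
Proof.
split=> [v|c] k x y /=; first by rewrite scalerDl scalerA.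
by rewrite scalerDr !scalerA mulrC.
Qed.

Lemma runit_bilin : bilin (fun (v : V) (c : R^o) => c *: v).
Proof. by have [? ?] := lunit_bilin; split. Qed.

Definition tens_lunit : {linear tens R^o V -> V} := tens_lift lunit_bilin.
Definition tens_runit : {linear tens V R^o -> V} := tens_lift runit_bilin.

Lemma tens_lunitE c v : tens_lunit (pure c v) = c *: v.
Proof. exact: tens_liftE. Qed.

Lemma tens_runitE v c : tens_runit (pure v c) = c *: v.
Proof. exact: tens_liftE. Qed.

Definition tens_lunitV : {linear V -> tens R^o V} :=
  mklin (proj2 (pure_bilin R^o V) 1).
Definition tens_runitV : {linear V -> tens V R^o} :=
  mklin (proj1 (pure_bilin V R^o) 1).

Lemma tens_lunitVE v : tens_lunitV v = pure (1 : R^o) v. Proof. by []. Qed.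
Lemma tens_runitVE v : tens_runitV v = pure v (1 : R^o). Proof. by []. Qed.

End Unitors.

Definition tensE := (tens_mapE, tens_symE, tens_assoE, tens_assoVE, tens_lunitE,
  tens_runitE, tens_lunitVE, tens_runitVE).

Lemma rcompE U V W (f : {linear U -> V}) (g : {linear V -> W}) x :
  (comp (f : @hom rvec_cat U V) (g : @hom rvec_cat V W) : {linear U -> W}) x
  = g (f x).
Proof. by []. Qed.

Lemma ridE V x : (idm (V : rvec_cat) : {linear V -> V}) x = x.
Proof. by []. Qed.

Lemma lin_zeroE V W x : lin_zero V W x = 0. Proof. by []. Qed.

Lemma lin_addE V W (f g : {linear V -> W}) x : lin_add f g x = f x + g x.
Proof. by []. Qed.

Let E := (rcompE, ridE, lin_zeroE, lin_addE, tensE).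

Definition RVec : asmc.
Proof.
refine (@ASMC rvec_cat lin_zero lin_add _ _ _ _ _ _ _
  (@tens R) tens_map _ _ _ _ _ _
  R^o tens_asso tens_assoV tens_lunit tens_lunitV tens_runit tens_runitV
  (fun V W => tens_sym V W) _ _ _ _ _ _ _ _ _ _ _ _ _ _).
- abstract (by move=> V W f g h; apply: lin_eq => x; rewrite !E addrA).
- abstract (by move=> V W f g; apply: lin_eq => x; rewrite !E addrC).
- abstract (by move=> V W f; apply: lin_eq => x; rewrite !E add0r).
- abstract (by move=> U V W f; apply: lin_eq => x; rewrite !E linear0).
- abstract (by move=> U V W f; apply: lin_eq => x; rewrite !E).
- abstract (by move=> U V W f g h; apply: lin_eq => x; rewrite !E linearD).
- abstract (by move=> U V W f g h; apply: lin_eq => x; rewrite !E).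
- abstract (by move=> V W; apply: tens_ext => v w; rewrite !E).
- abstract (by move=> *; apply: tens_ext => v w; rewrite !E).
- abstract (by move=> *; apply: tens_ext => v w; rewrite !E pure0l).
- abstract (by move=> *; apply: tens_ext => v w; rewrite !E pure0r).
- abstract (by move=> *; apply: tens_ext => v w; rewrite !E pureDl).
- abstract (by move=> *; apply: tens_ext => v w; rewrite !E pureDr).
- abstract (by move=> *; apply: tens_ext3l => a b c; rewrite !E).
- abstract (by move=> *; apply: tens_ext3r => a b c; rewrite !E).
- abstract (by move=> V; apply: tens_ext => c v; rewrite !E pureZr -pureZl [_ *: _]mulr1).
- abstract (by move=> V; apply: lin_eq => v; rewrite !E scale1r).
- abstract (by move=> V; apply: tens_ext => v c; rewrite !E pureZl -pureZr [_ *: _]mulr1).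
- abstract (by move=> V; apply: lin_eq => v; rewrite !E scale1r).
- abstract (by move=> V W; apply: tens_ext => v w; rewrite !E).
- abstract (by move=> *; apply: tens_ext3l => a b c; rewrite !E).
- abstract (by move=> *; apply: tens_ext => c v; rewrite !E linearZ).
- abstract (by move=> *; apply: tens_ext => c v; rewrite !E linearZ).
- abstract (by move=> *; apply: tens_ext => v w; rewrite !E).
- abstract (by move=> *; apply: tens_ext3l => a c b; rewrite !E pureZl pureZr).
- abstract (by move=> *; apply: tens_ext4 => a b c e; rewrite !E).
- abstract (by move=> *; apply: tens_ext3l => a b c; rewrite !E).
Defined.

End RVec.

Section CinfRings.
Variable R : realType.

Record cinfRing := CinfRing {
  csort :> Type;
  cop : forall m, smooth R m -> ('I_m -> csort) -> csort;
  cop_proj : forall m (i : 'I_m) a, cop (sproj R i) a = a i;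
  cop_comp : forall m n (g : smooth R m) (f : 'I_m -> smooth R n) a,
    cop (scomp g f) a = cop g (fun j => cop (f j) a) }.

HB.instance Definition _ (A : cinfRing) := gen_eqMixin (csort A).
HB.instance Definition _ (A : cinfRing) := gen_choiceMixin (csort A).

Section Underlying.
Variable A : cinfRing.
Implicit Types a b c : A.

Definition ar0 : 'I_0 -> A := fun i => False_rect A (notF (ltn_ord i)).
Definition ar1 a : 'I_1 -> A := fun _ => a.
Definition ar2 a b : 'I_2 -> A := tnth [tuple a; b].
Definition ar3 a b c : 'I_3 -> A := tnth [tuple a; b; c].

(* The operations given by the polynomials x0 + x1, x0 * x1, k and k * x0. *)
Definition c_add a b : A :=
  cop (sadd (sproj R (@Ordinal 2 0 isT)) (sproj R (@Ordinal 2 1 isT))) (ar2 a b).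
Definition c_mul a b : A :=
  cop (smul (sproj R (@Ordinal 2 0 isT)) (sproj R (@Ordinal 2 1 isT))) (ar2 a b).
Definition c_cst (k : R) : A := cop (scst 0 k) ar0.
Definition c_scale (k : R) a : A :=
  cop (smul (scst 1 k) (sproj R (@Ordinal 1 0 isT))) (ar1 a).

Lemma cop_add n (f g : smooth R n) (a : 'I_n -> A) :
  cop (sadd f g) a = c_add (cop f a) (cop g a).
Proof.
rewrite /c_add.
have -> : ar2 (cop f a) (cop g a) = (fun j => cop (tnth [tuple f; g] j) a).
  by apply/funext; case=> [[|[|//]] ?].
by rewrite -cop_comp; congr (cop _ _); apply: smooth_eq => x; rewrite /= !mxE.
Qed.

Lemma cop_mul n (f g : smooth R n) (a : 'I_n -> A) :
  cop (smul f g) a = c_mul (cop f a) (cop g a).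
Proof.
rewrite /c_mul.
have -> : ar2 (cop f a) (cop g a) = (fun j => cop (tnth [tuple f; g] j) a).
  by apply/funext; case=> [[|[|//]] ?].
by rewrite -cop_comp; congr (cop _ _); apply: smooth_eq => x; rewrite /= !mxE.
Qed.

Lemma cop_cst n (k : R) (a : 'I_n -> A) : cop (scst n k) a = c_cst k.
Proof.
rewrite /c_cst.
have -> : ar0 = (fun j : 'I_0 => cop (False_rect (smooth R n) (notF (ltn_ord j))) a).
  by apply/funext; case.
by rewrite -cop_comp; congr (cop _ _); apply: smooth_eq.
Qed.

Lemma cop_scale n (k : R) (f : smooth R n) (a : 'I_n -> A) :
  cop (smul (scst n k) f) a = c_scale k (cop f a).
Proof.
rewrite /c_scale.
have -> : ar1 (cop f a) = (fun j => cop (tnth [tuple f] j) a).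
  by apply/funext; case=> [[|//] ?].
by rewrite -cop_comp; congr (cop _ _); apply: smooth_eq => x; rewrite /= !mxE.
Qed.

Let p0 : smooth R 3 := sproj R (@Ordinal 3 0 isT).
Let p1 : smooth R 3 := sproj R (@Ordinal 3 1 isT).
Let p2 : smooth R 3 := sproj R (@Ordinal 3 2 isT).

Let q0 a b c : cop p0 (ar3 a b c) = a. Proof. exact: cop_proj. Qed.
Let q1 a b c : cop p1 (ar3 a b c) = b. Proof. exact: cop_proj. Qed.
Let q2 a b c : cop p2 (ar3 a b c) = c. Proof. exact: cop_proj. Qed.

Let E := (cop_add, cop_scale, cop_mul, cop_cst, q0, q1, q2).

Let cop_id (f g : smooth R 3) a b c :
  f =1 g -> cop f (ar3 a b c) = cop g (ar3 a b c).
Proof. by move=> /smooth_eq ->. Qed.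

Lemma c_addA : associative c_add.
Proof.
move=> a b c.
have /(cop_id a b c) : sadd p0 (sadd p1 p2) =1 sadd (sadd p0 p1) p2.
  by move=> x /=; rewrite addrA.
by rewrite !E.
Qed.

Lemma c_addC : commutative c_add.
Proof.
move=> a b; have /(cop_id a b b) : sadd p0 p1 =1 sadd p1 p0.
  by move=> x /=; rewrite addrC.
by rewrite !E.
Qed.

Lemma c_add0 : left_id (c_cst 0) c_add.
Proof.
move=> a; have /(cop_id a a a) : sadd (scst 3 0) p0 =1 p0.
  by move=> x /=; rewrite add0r.
by rewrite !E.
Qed.

Lemma c_addN : left_inverse (c_cst 0) (c_scale (-1)) c_add.
Proof.
move=> a.
have /(cop_id a a a) : sadd (smul (scst 3 (-1)) p0) p0 =1 scst 3 0.
  by move=> x /=; rewrite mulN1r addNr.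
by rewrite !E.
Qed.

HB.instance Definition _ :=
  GRing.isZmodule.Build (csort A) c_addA c_addC c_add0 c_addN.

Lemma c_mulA : associative c_mul.
Proof.
move=> a b c.
have /(cop_id a b c) : smul p0 (smul p1 p2) =1 smul (smul p0 p1) p2.
  by move=> x /=; rewrite mulrA.
by rewrite !E.
Qed.

Lemma c_mulC : commutative c_mul.
Proof.
move=> a b; have /(cop_id a b b) : smul p0 p1 =1 smul p1 p0.
  by move=> x /=; rewrite mulrC.
by rewrite !E.
Qed.

Lemma c_mul1 : left_id (c_cst 1) c_mul.
Proof.
move=> a; have /(cop_id a a a) : smul (scst 3 1) p0 =1 p0.
  by move=> x /=; rewrite mul1r.
by rewrite cop_mul !E.
Qed.

Lemma c_mulDl : left_distributive c_mul c_add.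
Proof.
move=> a b c.
have /(cop_id a b c) : smul (sadd p0 p1) p2 =1 sadd (smul p0 p2) (smul p1 p2).
  by move=> x /=; rewrite mulrDl.
by rewrite !E.
Qed.

HB.instance Definition _ :=
  GRing.Zmodule_isComPzRing.Build (csort A) c_mulA c_mulC c_mul1 c_mulDl.

Lemma c_scaleA (k l : R) a : c_scale k (c_scale l a) = c_scale (k * l) a.
Proof.
have /(cop_id a a a) : smul (scst 3 k) (smul (scst 3 l) p0)
                       =1 smul (scst 3 (k * l)) p0.
  by move=> x /=; rewrite mulrA.
by rewrite !E.
Qed.

Lemma c_scale1 : left_id 1 c_scale.
Proof.
move=> a; have /(cop_id a a a) : smul (scst 3 1) p0 =1 p0.
  by move=> x /=; rewrite mul1r.
by rewrite !E.
Qed.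

Lemma c_scaleDr : right_distributive c_scale c_add.
Proof.
move=> k a b.
have /(cop_id a b b) : smul (scst 3 k) (sadd p0 p1)
                       =1 sadd (smul (scst 3 k) p0) (smul (scst 3 k) p1).
  by move=> x /=; rewrite mulrDr.
by rewrite !E.
Qed.

Lemma c_scaleDl a : {morph c_scale^~ a : k l / k + l}.
Proof.
move=> k l.
have /(cop_id a a a) : smul (scst 3 (k + l)) p0
                       =1 sadd (smul (scst 3 k) p0) (smul (scst 3 l) p0).
  by move=> x /=; rewrite mulrDl.
by rewrite !E.
Qed.

HB.instance Definition _ := GRing.Zmodule_isLmodule.Build R (csort A)
  c_scaleA c_scale1 c_scaleDr c_scaleDl.

(* Together with the [lmodType] and [comPzRingType] structures, this makes [A] a
   commutative R-algebra. The zero ring is a C^infinity-ring, so [A] is not an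
   [algType], where 1 <> 0 is required. *)
Lemma c_scaleAl (k : R) a b : k *: (a * b) = (k *: a) * b :> A.
Proof.
have /(cop_id a b b) : smul (scst 3 k) (smul p0 p1)
                       =1 smul (smul (scst 3 k) p0) p1.
  by move=> x /=; rewrite mulrA.
by rewrite !E.
Qed.

Lemma c_cstE (k : R) : c_cst k = k *: (1 : A).
Proof.
have /(cop_id 0 0 0) : scst 3 k =1 smul (scst 3 k) (scst 3 1).
  by move=> x /=; rewrite mulr1.
by rewrite !E.
Qed.

End Underlying.

Record cinfHom (A B : cinfRing) := CinfHom {
  chfun :> A -> B;
  chP : forall m (f : smooth R m) (a : 'I_m -> A),
    chfun (cop f a) = cop f (fun j => chfun (a j)) }.

Lemma cinfHom_eq (A B : cinfRing) (f g : cinfHom A B) : f =1 g -> f = g.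
Proof.
case: f g => [f fP] [g gP] /= /funext fg; rewrite fg in fP *.
by congr CinfHom; exact: Prop_irrelevance.
Qed.

Definition cinf_id (A : cinfRing) : cinfHom A A :=
  @CinfHom A A id (fun _ _ _ => erefl).

Section CinfComp.
Variables (A B C : cinfRing) (f : cinfHom A B) (g : cinfHom B C).

Lemma cinf_comp_subproof m (h : smooth R m) (a : 'I_m -> A) :
  g (f (cop h a)) = cop h (fun j => g (f (a j))).
Proof. by rewrite !chP. Qed.

Definition cinf_comp : cinfHom A C :=
  @CinfHom A C (fun a => g (f a)) cinf_comp_subproof.

End CinfComp.

Lemma cinf_compE (A B C : cinfRing) (f : cinfHom A B) (g : cinfHom B C) a :
  cinf_comp f g a = g (f a).
Proof. by []. Qed.

Lemma cinf_comp1m (A B : cinfRing) (f : cinfHom A B) :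
  cinf_comp (cinf_id A) f = f.
Proof. exact: cinfHom_eq. Qed.

Lemma cinf_compm1 (A B : cinfRing) (f : cinfHom A B) :
  cinf_comp f (cinf_id B) = f.
Proof. exact: cinfHom_eq. Qed.

Lemma cinf_compA (A B C D : cinfRing) (f : cinfHom A B) (g : cinfHom B C)
    (h : cinfHom C D) :
  cinf_comp f (cinf_comp g h) = cinf_comp (cinf_comp f g) h.
Proof. exact: cinfHom_eq. Qed.

Definition CinfCat : category := Category cinf_comp1m cinf_compm1 cinf_compA.

Section HomLinear.
Variables (A B : cinfRing) (f : cinfHom A B).

Lemma cinfHom_ar2 (a b : A) : (fun j => f (ar2 a b j)) = ar2 (f a) (f b).
Proof. by apply/funext; case=> [[|[|//]] ?]. Qed.

Lemma cinfHomD (a b : A) : f (a + b) = f a + f b.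
Proof. by rewrite [LHS]chP cinfHom_ar2. Qed.

Lemma cinfHomM (a b : A) : f (a * b) = f a * f b.
Proof. by rewrite [LHS]chP cinfHom_ar2. Qed.

Lemma cinfHomZ (k : R) (a : A) : f (k *: a) = k *: f a.
Proof. by rewrite [LHS]chP. Qed.

Lemma cinfHom_cst (k : R) : f (c_cst A k) = c_cst B k.
Proof. by rewrite [LHS]chP; congr (cop _ _); apply/funext; case. Qed.

Lemma cinfHom_linear : linear f.
Proof. by move=> k a b; rewrite cinfHomD cinfHomZ. Qed.

Definition cinf_lin : {linear A -> B} := mklin cinfHom_linear.

End HomLinear.

Lemma cinf_lin1 (A : cinfRing) :
  cinf_lin (cinf_id A) = idm (A : RVec R) :> hom (A : RVec R) (A : RVec R).
Proof. exact: lin_eq. Qed.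

Lemma cinf_linM (A B C : cinfRing) (f : cinfHom A B) (g : cinfHom B C) :
  cinf_lin (cinf_comp f g)
  = comp (cinf_lin f : hom (A : RVec R) (B : RVec R))
         (cinf_lin g : hom (B : RVec R) (C : RVec R)).
Proof. exact: lin_eq. Qed.

Definition forget : functor CinfCat (RVec R) :=
  @Functor CinfCat (RVec R) (fun A : cinfRing => csort A : lmodType R)
    cinf_lin cinf_lin1 cinf_linM.

Section AlgebraMaps.
Variable A : cinfRing.

Lemma c_mul_bilin : bilin (fun a b : A => a * b).
Proof.
split=> [b|a] k x y; first by rewrite mulrDl c_scaleAl.
by rewrite mulrDr -[X in X + _ = _]mulrC -c_scaleAl [x * a]mulrC.
Qed.

Definition alg_mul : hom (forget A \ox forget A) (forget A) :=
  tens_lift c_mul_bilin.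

Lemma c_unit_linear : linear (fun k : R^o => k *: (1 : A)).
Proof. by move=> k x y; rewrite scalerDl scalerA. Qed.

Definition alg_unit : hom (tunit : RVec R) (forget A) := mklin c_unit_linear.

End AlgebraMaps.

Lemma smooth_cop_proj n m (i : 'I_m) (a : 'I_m -> smooth R n) :
  scomp (sproj R i) a = a i.
Proof. by apply: smooth_eq => x; rewrite /= mxE. Qed.

Lemma smooth_cop_comp n p m (g : smooth R p) (f : 'I_p -> smooth R m)
    (a : 'I_m -> smooth R n) :
  scomp (scomp g f) a = scomp g (fun j => scomp (f j) a).
Proof.
by apply: smooth_eq => x /=; congr (g _); apply/rowP => j; rewrite !mxE.
Qed.

Definition Cinf (n : nat) : cinfRing :=
  @CinfRing (smooth R n) (fun m g a => scomp g a)
    (@smooth_cop_proj n) (@smooth_cop_comp n).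

End CinfRings.

(* A left adjoint of [forget] exists: the terms over V built from the operations,
   two terms being identified when every linear map from V to a C^infinity-ring
   evaluates them to the same element. *)
Section Free.
Variables (R : realType) (V : lmodType R).

Inductive cterm : Type :=
| CVar of V
| COp m of smooth R m & ('I_m -> cterm).

HB.instance Definition _ := gen_eqMixin cterm.
HB.instance Definition _ := gen_choiceMixin cterm.

Fixpoint ceval (A : cinfRing R) (h : V -> A) (t : cterm) : A :=
  match t with
  | CVar v => h v
  | COp m f ts => cop f (fun i => ceval h (ts i))
  end.

Definition cterm_rel (s t : cterm) : bool :=
  `[< forall (A : cinfRing R) (h : {linear V -> A}), ceval h s = ceval h t >].

Lemma cterm_rel_refl : reflexive cterm_rel.
Proof. by move=> s; apply/asboolP. Qed.

Lemma cterm_rel_sym : symmetric cterm_rel.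
Proof. by move=> s t; apply/asboolP/asboolP => st A h. Qed.

Lemma cterm_rel_trans : transitive cterm_rel.
Proof.
move=> t s r /asboolP st /asboolP tr; apply/asboolP => A h.
by rewrite st tr.
Qed.

Canonical cterm_equiv :=
  EquivRel cterm_rel cterm_rel_refl cterm_rel_sym cterm_rel_trans.

Definition cfree_sort : Type := {eq_quot cterm_equiv}%qT.

Definition cfree_mk (t : cterm) : cfree_sort := (\pi_({eq_quot cterm_equiv}) t)%qT.

Definition cfree_repr (x : cfree_sort) : cterm := repr (x : {eq_quot cterm_equiv}%qT).

Lemma cfree_reprK x : cfree_mk (cfree_repr x) = x.
Proof. exact: (@reprK _ {eq_quot cterm_equiv}%qT). Qed.

Definition cfree_op m (f : smooth R m) (a : 'I_m -> cfree_sort) : cfree_sort :=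
  cfree_mk (COp f (fun i => cfree_repr (a i))).

Lemma cfree_evalK (A : cinfRing R) (h : {linear V -> A}) t :
  ceval h (cfree_repr (cfree_mk t)) = ceval h t.
Proof.
have /eqmodP/asboolP : (cfree_repr (cfree_mk t) = t %[mod_eq cterm_equiv])%qT.
  exact: cfree_reprK.
exact.
Qed.

Lemma cfree_mk_eq s t :
  (forall (A : cinfRing R) (h : {linear V -> A}), ceval h s = ceval h t) ->
  cfree_mk s = cfree_mk t.
Proof. by move=> st; apply/eqmodP/asboolP. Qed.

Lemma cfree_op_mk m (f : smooth R m) (ts : 'I_m -> cterm) :
  cfree_op f (fun i => cfree_mk (ts i)) = cfree_mk (COp f ts).
Proof.
apply: cfree_mk_eq => A h /=; congr cop; apply/funext => i.
exact: cfree_evalK.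
Qed.

Lemma cfree_proj m (i : 'I_m) (a : 'I_m -> cfree_sort) :
  cfree_op (sproj R i) a = a i.
Proof.
by rewrite -[RHS]cfree_reprK; apply: cfree_mk_eq => A h /=; rewrite cop_proj.
Qed.

Lemma cfree_comp m n (g : smooth R m) (f : 'I_m -> smooth R n)
    (a : 'I_n -> cfree_sort) :
  cfree_op (scomp g f) a = cfree_op g (fun j => cfree_op (f j) a).
Proof.
by rewrite cfree_op_mk; apply: cfree_mk_eq => A h /=; rewrite cop_comp.
Qed.

Definition cfree : cinfRing R := CinfRing cfree_proj cfree_comp.

Section Lift.
Variables (A : cinfRing R) (h : {linear V -> A}).

Definition cfree_lift_fun (x : cfree) : A := ceval h (cfree_repr x).

Lemma cfree_lift_subproof m (f : smooth R m) (a : 'I_m -> cfree) :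
  cfree_lift_fun (cop f a) = cop f (fun j => cfree_lift_fun (a j)).
Proof. by rewrite /cfree_lift_fun /= /cfree_op cfree_evalK. Qed.

Definition cfree_lift : cinfHom cfree A := CinfHom cfree_lift_subproof.

End Lift.

Definition cfree_var (v : V) : cfree := cfree_mk (CVar v).

Lemma cfree_lift_var (A : cinfRing R) (h : {linear V -> A}) v :
  cfree_lift h (cfree_var v) = h v.
Proof. exact: cfree_evalK. Qed.

Lemma cfree_sep (x y : cfree) :
  (forall (A : cinfRing R) (h : {linear V -> A}),
     cfree_lift h x = cfree_lift h y) -> x = y.
Proof.
by move=> xy; rewrite -[x]cfree_reprK -[y]cfree_reprK; apply: cfree_mk_eq.
Qed.

Lemma cfree_var_linear : linear cfree_var.
Proof.
move=> k x y; apply: cfree_sep => A h.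
by rewrite cinfHomD cinfHomZ !cfree_lift_var linearP.
Qed.

Definition cfree_eta : {linear V -> cfree} := mklin cfree_var_linear.

Lemma cfree_ext (A : cinfRing R) (f g : cinfHom cfree A) :
  (forall v, f (cfree_var v) = g (cfree_var v)) -> f = g.
Proof.
move=> fg; apply: cinfHom_eq => x; rewrite -[x]cfree_reprK.
elim: (cfree_repr x) => [//|m h ts IH]; rewrite -cfree_op_mk.
have chE (k : cinfHom cfree A) := chP k h (fun i => cfree_mk (ts i)).
by rewrite [LHS]chE [RHS]chE; congr cop; apply/funext.
Qed.

End Free.

Section FreeAdjunction.
Variable R : realType.

Definition cfree_map (V W : lmodType R) (f : {linear V -> W}) :
  cinfHom (cfree V) (cfree W) := cfree_lift (lin_comp f (cfree_eta W)).

Lemma cfree_map_var (V W : lmodType R) (f : {linear V -> W}) v :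
  cfree_map f (cfree_var v) = cfree_var (f v).
Proof. exact: cfree_lift_var. Qed.

Lemma cfree_map1 (V : lmodType R) : cfree_map (lin_id V) = cinf_id (cfree V).
Proof. by apply: cfree_ext => v; rewrite cfree_map_var. Qed.

Lemma cfree_mapM (U V W : lmodType R) (f : {linear U -> V}) (g : {linear V -> W}) :
  cfree_map (lin_comp f g) = cinf_comp (cfree_map f) (cfree_map g).
Proof. by apply: cfree_ext => v; rewrite cinf_compE !cfree_map_var. Qed.

Definition cfreeF : functor (RVec R) (CinfCat R) :=
  @Functor (RVec R) (CinfCat R) (@cfree R) cfree_map cfree_map1 cfree_mapM.

Lemma cfree_eta_nat (V W : RVec R) (f : hom V W) :
  comp f (cfree_eta W : hom W (forget R (cfreeF W)))
  = comp (cfree_eta V : hom V (forget R (cfreeF V)))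
         (fmap (cfreeF ;; forget R) f).
Proof. by apply: lin_eq => v; exact: esym (cfree_map_var f v). Qed.

Definition cfree_unit : nattrans (idF (RVec R)) (cfreeF ;; forget R) :=
  @NatTrans _ _ (idF (RVec R)) (cfreeF ;; forget R) (@cfree_eta R) cfree_eta_nat.

Definition cfree_eps (A : cinfRing R) : cinfHom (cfree A) A :=
  cfree_lift (lin_id A).

Lemma cfree_eps_var (A : cinfRing R) (a : A) : cfree_eps A (cfree_var a) = a.
Proof. exact: cfree_lift_var. Qed.

Lemma cfree_eps_nat (A B : cinfRing R) (f : cinfHom A B) :
  cinf_comp (cfree_map (cinf_lin f)) (cfree_eps B)
  = cinf_comp (cfree_eps A) f.
Proof.
by apply: cfree_ext => a; rewrite !cinf_compE cfree_map_var !cfree_eps_var.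
Qed.

Definition cfree_counit : nattrans (forget R ;; cfreeF) (idF (CinfCat R)) :=
  @NatTrans _ _ (forget R ;; cfreeF) (idF (CinfCat R)) cfree_eps cfree_eps_nat.

Lemma cfree_triL (V : lmodType R) :
  cinf_comp (cfree_map (cfree_eta V)) (cfree_eps (cfree V)) = cinf_id (cfree V).
Proof.
by apply: cfree_ext => v; rewrite cinf_compE cfree_map_var cfree_eps_var.
Qed.

Lemma cfree_triR (A : cinfRing R) :
  lin_comp (cfree_eta A) (cinf_lin (cfree_eps A)) = lin_id A.
Proof. by apply: lin_eq => a; exact: cfree_eps_var. Qed.

Definition cfree_adj : adjunction cfreeF (forget R) :=
  @Adjunction _ _ cfreeF (forget R) cfree_unit cfree_counit cfree_triL cfree_triR.

End FreeAdjunction.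

Section FreeMonad.
Variables (R : realType) (L : functor (RVec R) (CinfCat R)).
Variable adj : adjunction L (forget R).

Definition Sinf : functor (RVec R) (RVec R) := adj_monad L (forget R).
Definition Sinf_mu : nattrans (Sinf ;; Sinf) Sinf := adj_mu adj.
Definition Sinf_eta : nattrans (idF (RVec R)) Sinf := adj_eta adj.

Lemma Sinf_m_nat (V W : RVec R) (f : hom V W) :
  comp (fmap (tensF Sinf Sinf) f) (alg_mul (L W))
  = comp (alg_mul (L V)) (fmap Sinf f).
Proof.
apply: tens_ext => a b.
rewrite [LHS]rcompE [RHS]rcompE.
rewrite [X in _ X = _]tens_mapE [LHS]tens_liftE [X in _ = _ X]tens_liftE.
exact: esym (cinfHomM (fmap L f) a b).
Qed.

Definition Sinf_m : nattrans (tensF Sinf Sinf) Sinf :=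
  @NatTrans _ _ (tensF Sinf Sinf) Sinf (fun V => alg_mul (L V)) Sinf_m_nat.

Lemma Sinf_u_nat (V W : RVec R) (f : hom V W) :
  comp (fmap (constF (RVec R) (tunit : RVec R)) f) (alg_unit (L W))
  = comp (alg_unit (L V)) (fmap Sinf f).
Proof.
apply: lin_eq => k; rewrite [LHS]rcompE [RHS]rcompE.
have := cinfHom_cst (fmap L f) k; rewrite !c_cstE => kE; exact: esym kE.
Qed.

Definition Sinf_u : nattrans (constF (RVec R) (tunit : RVec R)) Sinf :=
  @NatTrans _ _ (constF (RVec R) (tunit : RVec R)) Sinf
    (fun V => alg_unit (L V)) Sinf_u_nat.

Definition rapp (V W : lmodType R) (f : @hom (RVec R) V W) : V -> W :=
  (f : {linear V -> W}).

Definition Rn (n : nat) : lmodType R := 'rV[R]_n.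

Local Notation e_ n i := (delta_mx 0 i : Rn n).

(* The identification of C^infinity(R^n) with S^infinity(R^n): the morphism of
   C^infinity-rings that sends the i-th projection to [eta (e_i)]. *)
Definition Sinf_of_smooth_fun n (f : Cinf R n) : L (Rn n) :=
  @cop R (L (Rn n)) n f (fun i => rapp (Sinf_eta (Rn n)) (e_ n i)).

Lemma Sinf_of_smooth_subproof n m (g : smooth R m) (f : 'I_m -> Cinf R n) :
  Sinf_of_smooth_fun (cop g f) = cop g (fun j => Sinf_of_smooth_fun (f j)).
Proof. exact: cop_comp. Qed.

Definition Sinf_of_smooth n : @hom (CinfCat R) (Cinf R n) (L (Rn n)) :=
  CinfHom (@Sinf_of_smooth_subproof n).

Lemma Sinf_of_smooth_proj n (i : 'I_n) :
  Sinf_of_smooth_fun (sproj R i : Cinf R n) = rapp (Sinf_eta (Rn n)) (e_ n i).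
Proof. exact: cop_proj. Qed.

Lemma lin_form_linear n :
  linear (fun x : Rn n => \sum_i x 0 i *: (sproj R i : Cinf R n)).
Proof.
move=> k x y; rewrite scaler_sumr -big_split; apply: eq_bigr => i _ /=.
by rewrite !mxE scalerDl scalerA.
Qed.

Definition lin_form n : hom (Rn n : RVec R) (forget R (Cinf R n)) :=
  mklin (@lin_form_linear n).

Definition smooth_of_Sinf n : @hom (CinfCat R) (L (Rn n)) (Cinf R n) :=
  adj_transpose adj (lin_form n).

Lemma smooth_of_Sinf_eta n (x : Rn n) :
  (smooth_of_Sinf n : cinfHom _ _) (rapp (Sinf_eta (Rn n)) x)
  = \sum_i x 0 i *: (sproj R i : Cinf R n).
Proof.
have := adj_transposeK adj (lin_form n).
by move=> /(congr1 (fun h => rapp h x)).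
Qed.

Lemma Sinf_of_smoothK n : comp (Sinf_of_smooth n) (smooth_of_Sinf n) = idm _.
Proof.
apply: cinfHom_eq => f; rewrite cinf_compE.
rewrite [LHS](chP (smooth_of_Sinf n : cinfHom _ _) f).
transitivity (scomp f (fun i => sproj R i)); last first.
  by apply: smooth_eq => x /=; congr (f _); apply/rowP => i; rewrite !mxE.
congr (scomp f _); apply/funext => i; rewrite smooth_of_Sinf_eta.
have eE j : (e_ n i) 0 j = (j == i)%:R by rewrite mxE eqxx.
rewrite (bigD1 i) // big1 => [|j /negPf ji].
  by rewrite eE eqxx scale1r; exact: (@addr0 (csort (Cinf R n)) (sproj R i : Cinf R n)).
by rewrite eE ji scale0r.
Qed.

Lemma smooth_of_SinfK n : comp (smooth_of_Sinf n) (Sinf_of_smooth n) = idm _.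
Proof.
apply: (adj_ext (adj := adj)); apply: lin_eq => x.
rewrite fmap1 compm1 fmapM compA rcompE.
rewrite -[X in _ X = _]/(rapp _ x).
rewrite -[X in rapp X _]/(comp (adj_unit adj (Rn n)) (fmap (forget R) _)).
rewrite adj_transposeK.
transitivity (\sum_i x 0 i *: rapp (Sinf_eta (Rn n)) (e_ n i)).
  rewrite [LHS](linear_sum (cinf_lin (Sinf_of_smooth n : cinfHom _ _))).
  apply: eq_bigr => i _; rewrite linearZ; congr (_ *: _).
  exact: Sinf_of_smooth_proj.
rewrite [x in RHS]row_sum_delta.
rewrite [RHS](linear_sum (Sinf_eta (Rn n) : {linear _ -> _})).
by apply: eq_bigr => i _; rewrite [RHS]linearZ.
Qed.

Definition deriv_formula (d : nattrans Sinf (tensF Sinf (idF (RVec R)))) :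
    Prop :=
  forall n (f : Cinf R n),
    rapp (d (Rn n)) (Sinf_of_smooth_fun f)
    = \sum_(i < n) pure (Sinf_of_smooth_fun (spartial i f)) (e_ n i).

End FreeMonad.

(* Main.v *)
Require Import Defs.
From mathcomp Require Import all_boot all_order all_algebra.
From mathcomp Require Import all_classical all_reals all_analysis.

(* For a module M over a C^infinity-ring A, the square-zero extension A (+) M is
   a C^infinity-ring with
     f (a, x) = (f a, sum_i (d_i f) a . x_i),
   the axiom on compositions being the chain rule. The linear map
   v |-> (eta v, 1 \ox v) from V to S(V) (+) (S(V) \ox V) extends to a morphism
   of C^infinity-rings on S(V), and d is its second component.
   Every element of S(V) is f (eta v_1, ..., eta v_n) for a single smooth f, and
   d sends it to sum_i (d_i f) (eta v_1, ..., eta v_n) \ox v_i. This determines d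
   from its values at the spaces R^n, and reduces the axioms to identities
   between partial derivatives; the last one is the symmetry of second
   derivatives. *)

(* The libraries imported after Defs reuse some of its names, such as hom. *)
Import Defs.

Set Implicit Arguments.
Unset Strict Implicit.
Unset Printing Implicit Defensive.

Import Order.TTheory GRing.Theory Num.Theory.
Import numFieldNormedType.Exports.
Local Open Scope ring_scope.
Local Open Scope cat_scope.

(** * Symmetry of second derivatives *)

Section MixedDerivatives.
Variables (R : realType) (V : normedModType R).
Implicit Types (f g : V -> R) (u v x : V).

Lemma is_derive_line g x v (t : R) : differentiable g (x + t *: v) ->
  is_derive t 1 (fun s : R => g (x + s *: v)) ('D_v g (x + t *: v)).
Proof.
move=> /diff_derivable dg.
have qE : (fun h : R => h^-1 *: (((fun s : R => g (x + s *: v)) \o shift t) (h *: 1)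
                         - g (x + t *: v)))
        = (fun h : R => h^-1 *: ((g \o shift (x + t *: v)) (h *: v) - g (x + t *: v))).
  apply/funext => h /=; congr (_ *: (g _ - _)).
  by rewrite [h *: 1]mulr1 scalerDl addrCA.
by split; [rewrite /derivable qE; exact: dg|rewrite /derive qE].
Qed.

Lemma MVT_line g x v (h : R) : 0 <= h -> (forall y, differentiable g y) ->
  exists2 t, 0 <= t <= h & g (x + h *: v) - g x = h * 'D_v g (x + t *: v).
Proof.
move=> h0 dg.
have [||t] := @MVT_segment R (fun s => g (x + s *: v))
  (fun s => 'D_v g (x + s *: v)) 0 h h0.
- by move=> t _; exact: is_derive_line.
- apply: continuous_subspaceT => t.
  apply: differentiable_continuous; apply/derivable1_diffP.
  by have [] := is_derive_line (dg (x + t *: v)).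
- by rewrite in_itv /= scale0r addr0 subr0 mulrC; exists t.
Qed.

(** The mean value theorem is used twice: along [u] for the increment [g] of [f] in direction [v],
    then along [v] for the derivative of [f] in direction [u]. *)
Lemma second_difference f u v x (h : R) : 0 <= h ->
  (forall y, differentiable f y) -> (forall y, differentiable ('D_u f) y) ->
  exists st : R * R, [/\ 0 <= st.1 <= h, 0 <= st.2 <= h &
    f (x + h *: u + h *: v) - f (x + h *: u) - (f (x + h *: v) - f x)
    = h * (h * 'D_v ('D_u f) (x + st.1 *: u + st.2 *: v))].
Proof.
move=> h0 df du; pose g y := f (y + h *: v) - f y.
have dsh y : differentiable (fun z => f (z + h *: v)) y.
  by apply: (@differentiable_comp _ _ _ _ (shift (h *: v)) f).
have dg y : differentiable g y by exact: differentiableB.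
have gE y : 'D_u g y = 'D_u f (y + h *: v) - 'D_u f y.
  have := @deriveB _ _ _ (fun z => f (z + h *: v)) f y u.
  rewrite /g => ->; [|exact: (@diff_derivable _ _ _ _ _ u (dsh y))
                     |exact: (@diff_derivable _ _ _ _ _ u (df y))].
  congr (_ - _); rewrite /derive.
  by under eq_fun => k do rewrite /= -[X in f X]addrA.
have [s sh gs] := MVT_line x u h0 dg.
have [t th ft] := MVT_line (x + s *: u) v h0 du.
by exists (s, t); split=> //; rewrite -ft -gE -gs.
Qed.

(** The second difference is symmetric in [u] and [v], and either order of the two mean value steps
    expresses it as [h * h] times a mixed derivative at a point near [x]. Continuity of both mixed
    derivatives at [x] then bounds their difference by any [e > 0]. *)
Lemma derive_swap f u v x :
  (forall y, differentiable f y) -> (forall y, differentiable ('D_u f) y) ->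
  (forall y, differentiable ('D_v f) y) ->
  {for x, continuous ('D_v ('D_u f))} -> {for x, continuous ('D_u ('D_v f))} ->
  'D_v ('D_u f) x = 'D_u ('D_v f) x.
Proof.
move=> df du dv cvu cuv; apply/eqP; rewrite -subr_eq0 -normr_le0.
apply/ler_addgt0Pr => e e0; rewrite add0r.
have close (a b c : R) : `|a - c| < e / 2 -> `|b - c| < e / 2 -> `|a - b| <= e.
  move=> ac bc; rewrite (le_trans (ler_distD c _ _)) // [e]splitr.
  by rewrite lerD // ltW // distrC.
have e20 : 0 < e / 2 by rewrite divr_gt0.
have [r1 r10 b1] := (nbhs_ballP _ _).1 (@cvgr_dist_lt _ _ _ _ _ _ _ cvu _ e20).
have [r2 r20 b2] := (nbhs_ballP _ _).1 (@cvgr_dist_lt _ _ _ _ _ _ _ cuv _ e20).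
pose r := Num.min r1 r2; have r0 : 0 < r by rewrite lt_min r10.
(* Both intermediate points lie within [h * (K - 1)] of [x], which is less than [h * K = r]; the
   added 1 keeps [K] positive when [u] and [v] vanish. *)
pose K := `|u| + `|v| + 1.
have K0 : 0 < K by rewrite ltr_wpDl // addr_ge0.
pose h := r / K; have h0 : 0 < h by rewrite divr_gt0.
have near (a b : V) (s t : R) : `|a| + `|b| + 1 = K -> 0 <= s <= h -> 0 <= t <= h ->
    `|x - (x + s *: a + t *: b)| < r.
  move=> abK /andP[s0 sh] /andP[t0 th].
  rewrite -addrA opprD addNKr normrN.
  rewrite (le_lt_trans (ler_normD _ _)) // !normrZ (ger0_norm s0) (ger0_norm t0).
  rewrite (@le_lt_trans _ _ (h * (`|a| + `|b|))) //.
    by rewrite mulrDr lerD // ler_wpM2r.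
  have -> : r = h * K by rewrite /h divfK // gt_eqF.
  by rewrite ltr_pM2l // -abK ltrDl.
have [[s t] /= [sh th E1]] := second_difference v x (ltW h0) df du.
have [[t' s'] /= [th' sh' E2]] := second_difference u x (ltW h0) df dv.
(* [E1] and [E2] evaluate the same second difference, so the two factors [h] can be cancelled. *)
have : 'D_v ('D_u f) (x + s *: u + t *: v) = 'D_u ('D_v f) (x + t' *: v + s' *: u).
  apply: (mulfI (lt0r_neq0 h0)); apply: (mulfI (lt0r_neq0 h0)).
  have xE : x + h *: v + h *: u = x + h *: u + h *: v by exact: addrAC.
  apply: (etrans (esym E1)); apply: etrans E2; rewrite xE.
  rewrite !opprB !addrA addrAC -!addrA; congr (_ + _); rewrite addrCA.
  congr (_ + _); exact: addrC.
have /b1 : ball x r1 (x + s *: u + t *: v).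
  by rewrite -ball_normE /ball_ /= (lt_le_trans (near u v s t _ _ _)) // ge_min lexx.
have /b2 : ball x r2 (x + t' *: v + s' *: u).
  rewrite -ball_normE /ball_ /= (lt_le_trans (near v u t' s' _ _ _)) ?ge_min ?lexx ?orbT //.
  by rewrite [`|v| + _]addrC.
move=> H2 H1 E; rewrite E in H1; exact: close H1 H2.
Qed.

End MixedDerivatives.

(** * Smooth functions and square-zero extensions *)

Section SmoothCalculus.
Variable R : realType.

Lemma spartialC n (i j : 'I_n) (f : smooth R n) :
  spartial i (spartial j f) = spartial j (spartial i f).
Proof.
have smooth_differentiable (g : smooth R n) y : differentiable g y.
  exact: is_smooth_diff (smoothP g).
apply: smooth_eq => x.
by apply: derive_swap => [y|y|y||];
  first [exact: (smooth_differentiable f)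
        |exact: (smooth_differentiable (spartial _ f))
        |apply: differentiable_continuous;
         exact: (smooth_differentiable (spartial _ (spartial _ f)))].
Qed.

Lemma Cinf_addE n (f g : Cinf R n) (x : 'rV[R]_n) :
  @Defs.sfun R n (f + g) x = Defs.sfun f x + Defs.sfun g x.
Proof. by rewrite /= !mxE. Qed.

Lemma Cinf_sumE n (I : Type) (r : seq I) (F : I -> Cinf R n) (x : 'rV[R]_n) :
  @Defs.sfun R n (\sum_(i <- r) F i) x = \sum_(i <- r) Defs.sfun (F i) x.
Proof.
elim: r => [|i r IHr]; first by rewrite !big_nil.
by rewrite !big_cons Cinf_addE IHr.
Qed.

Lemma spartial_scst n (i : 'I_n) (k : R) : spartial i (scst n k) = scst n 0.
Proof. by apply: smooth_eq => x; rewrite /= /partial derive_cst. Qed.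

Lemma spartial_sproj n (i j : 'I_n) :
  spartial i (sproj R j) = scst n (i == j)%:R.
Proof.
apply: smooth_eq => x; rewrite /= /partial deriveE; last exact: differentiable_coord.
have @cl : {linear 'rV[R]_n -> R}.
  by exists (fun y : 'rV[R]_n => y 0 j); do 2![eexists]; do ?[constructor];
     rewrite ?mxE// => ? *; rewrite ?mxE//; move=> ?; rewrite !mxE.
rewrite (_ : (fun y : 'rV[R]_n => y 0 j) = cl) // diff_lin //.
  by rewrite /cl /= mxE eqxx eq_sym.
by move=> y; exact: (@coord_continuous R 1 n 0 j y).
Qed.

Lemma spartial_sadd n (i : 'I_n) (f g : smooth R n) :
  spartial i (sadd f g) = sadd (spartial i f) (spartial i g).
Proof.
apply: smooth_eq => x /=.
by rewrite partialD // => y; apply: is_smooth_diff; exact: smoothP.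
Qed.

Lemma spartial_smul n (i : 'I_n) (f g : smooth R n) :
  spartial i (smul f g) = sadd (smul f (spartial i g)) (smul g (spartial i f)).
Proof.
apply: smooth_eq => x /=.
by rewrite partialM // => y; apply: is_smooth_diff; exact: smoothP.
Qed.

Lemma spartial_scomp m n (i : 'I_n) (g : smooth R m) (f : 'I_m -> smooth R n) :
  spartial i (scomp g f)
  = \sum_j (smul (scomp (spartial j g) f) (spartial i (f j)) : Cinf R n).
Proof.
apply: smooth_eq => x; rewrite Cinf_sumE /= partial_comp //.
- by apply: is_smooth_diff; exact: smoothP.
- by move=> j; apply: is_smooth_diff; exact: smoothP.
Qed.

Lemma cop_sum (A : cinfRing R) n (a : 'I_n -> A) I (r : seq I) (F : I -> Cinf R n) :
  cop (\sum_(i <- r) F i : Cinf R n) a = \sum_(i <- r) cop (F i) a.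
Proof.
(* By the composition axiom, evaluation at [a] is a morphism of C^infinity-rings from [Cinf R n] to
   [A], hence linear. *)
have evP m (f : smooth R m) (b : 'I_m -> Cinf R n) :
  cop (cop f b : Cinf R n) a = cop f (fun j => cop (b j) a) by exact: cop_comp.
exact: (linear_sum (cinf_lin (@CinfHom R (Cinf R n) A (fun f => cop f a) evP))).
Qed.

End SmoothCalculus.

(* [M] is an [A]-module through [act]. *)
Section SquareZero.
Variables (R : realType) (A : cinfRing R) (M : lmodType R).
Variable act : A -> {linear M -> M}.
Hypothesis act1 : forall x, act 1 x = x.
Hypothesis actM : forall a b x, act (a * b) x = act a (act b x).
Hypothesis actD : forall a b x, act (a + b) x = act a x + act b x.
Hypothesis actZ : forall (k : R) a x, act (k *: a) x = k *: act a x.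

Lemma act_sum I (r : seq I) (F : I -> A) x :
  act (\sum_(i <- r) F i) x = \sum_(i <- r) act (F i) x.
Proof.
elim: r => [|i r IHr]; last by rewrite !big_cons actD IHr.
by rewrite !big_nil -(scale0r 0) actZ scale0r.
Qed.

Lemma act_cst (k : R) x : act (c_cst A k) x = k *: x.
Proof. by rewrite c_cstE actZ act1. Qed.

Definition cop_diff m (f : smooth R m) (a : 'I_m -> A) (x : 'I_m -> M) : M :=
  \sum_i act (cop (spartial i f) a) (x i).

Lemma cop_diff_proj m (i : 'I_m) a x : cop_diff (sproj R i) a x = x i.
Proof.
rewrite /cop_diff (bigD1 i) //= big1 => [|j /negPf ji];
  rewrite spartial_sproj cop_cst act_cst.
  by rewrite eqxx scale1r addr0.
by rewrite ji scale0r.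
Qed.

Lemma cop_diff_comp m n (g : smooth R m) (f : 'I_m -> smooth R n) a x :
  cop_diff (scomp g f) a x
  = cop_diff g (fun j => cop (f j) a) (fun j => cop_diff (f j) a x).
Proof.
rewrite /cop_diff; under eq_bigr do rewrite spartial_scomp cop_sum act_sum.
rewrite exchange_big; apply: eq_bigr => j _; rewrite linear_sum.
by apply: eq_bigr => i _; rewrite cop_mul actM cop_comp.
Qed.

Lemma cop_diff_add m (f g : smooth R m) a x :
  cop_diff (sadd f g) a x = cop_diff f a x + cop_diff g a x.
Proof.
rewrite /cop_diff -big_split; apply: eq_bigr => i _.
by rewrite spartial_sadd cop_add actD.
Qed.

Lemma cop_diff_mul m (f g : smooth R m) a x :
  cop_diff (smul f g) a x
  = act (cop f a) (cop_diff g a x) + act (cop g a) (cop_diff f a x).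
Proof.
rewrite /cop_diff !linear_sum -big_split; apply: eq_bigr => i _.
by rewrite spartial_smul cop_add !cop_mul actD !actM.
Qed.

Lemma cop_diff_cst m (k : R) a x : cop_diff (scst m k) a x = 0.
Proof.
by rewrite /cop_diff big1 // => i _; rewrite spartial_scst cop_cst act_cst scale0r.
Qed.

Definition sqz_op m (f : smooth R m) (p : 'I_m -> A * M) : A * M :=
  (cop f (fun i => (p i).1), cop_diff f (fun i => (p i).1) (fun i => (p i).2)).

Lemma sqz_proj m (i : 'I_m) p : sqz_op (sproj R i) p = p i.
Proof. by rewrite /sqz_op cop_proj cop_diff_proj; case: (p i). Qed.

Lemma sqz_comp m n (g : smooth R m) (f : 'I_m -> smooth R n) p :
  sqz_op (scomp g f) p = sqz_op g (fun j => sqz_op (f j) p).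
Proof. by rewrite /sqz_op cop_comp cop_diff_comp. Qed.

Definition sqz : cinfRing R := CinfRing sqz_proj sqz_comp.

Definition sqz_fst : cinfHom sqz A :=
  @CinfHom R sqz A fst (fun _ _ _ => erefl).

(** The vector space structure of [sqz] is the one induced by its operations, not the product
    structure by definition. The differentials of [x0 + x1] and [k * x0] show that the two agree on
    the second component. *)
Lemma sqz_snd_linear : linear (snd : sqz -> M).
Proof.
move=> k p q; rewrite [LHS]cop_diff_add !cop_diff_proj /=.
by rewrite cop_diff_mul cop_diff_cst linear0 addr0 cop_cst act_cst cop_diff_proj.
Qed.

Definition sqz_snd : {linear sqz -> M} := mklin sqz_snd_linear.

Lemma sqz_pair_linear (V : lmodType R) (h : {linear V -> A}) (t : {linear V -> M}) :
  linear (fun v => (h v, t v) : sqz).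
Proof.
move=> k v w; rewrite [RHS]surjective_pairing; congr pair.
  by rewrite -[RHS]/(sqz_fst _) cinfHom_linear linearP.
by rewrite -[RHS]/(sqz_snd _) [RHS]linearP [LHS]linearP.
Qed.

Definition sqz_pair (V : lmodType R) (h : {linear V -> A}) (t : {linear V -> M}) :
  {linear V -> sqz} := mklin (sqz_pair_linear h t).

End SquareZero.

(** * The free C^infinity-ring *)

Section TensorModule.
Variables (R : realType) (A : cinfRing R) (V : lmodType R).
Implicit Types (a b : A) (x : tens A V).

Lemma mull_linear a : linear (fun b : A => a * b).
Proof. exact: (proj2 (c_mul_bilin A) a). Qed.

Definition tens_act a : {linear tens A V -> tens A V} :=
  tens_map (mklin (mull_linear a)) (lin_id V).

Lemma tens_act_pure a b v : tens_act a (pure b v) = pure (a * b) v.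
Proof. exact: tens_mapE. Qed.

Lemma tens_act1 x : tens_act 1 x = x.
Proof.
move: x; apply: tens_ind => [|x y IHx IHy|b v]; first exact: linear0.
  by rewrite linearD IHx IHy.
by rewrite tens_act_pure mul1r.
Qed.

Lemma tens_actM a b x : tens_act (a * b) x = tens_act a (tens_act b x).
Proof.
move: x; apply: tens_ind => [|x y IHx IHy|c v]; first by rewrite !linear0.
  by rewrite !linearD IHx IHy.
by rewrite !tens_act_pure mulrA.
Qed.

Lemma tens_actD a b x : tens_act (a + b) x = tens_act a x + tens_act b x.
Proof.
move: x; apply: tens_ind => [|x y IHx IHy|c v].
- by rewrite !linear0 addr0.
- by rewrite !linearD IHx IHy addrACA.
- by rewrite !tens_act_pure mulrDl pureDl.
Qed.

Lemma tens_actZ (k : R) a x : tens_act (k *: a) x = k *: tens_act a x.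
Proof.
move: x; apply: tens_ind => [|x y IHx IHy|c v].
- by rewrite !linear0.
- by rewrite !linearD IHx IHy.
- by rewrite !tens_act_pure -c_scaleAl pureZl.
Qed.

End TensorModule.

Lemma cfree_normal (R : realType) (V : lmodType R) (x : cfree V) :
  exists n (f : smooth R n) (v : 'I_n -> V), x = cop f (fun i => cfree_var (v i)).
Proof.
(* The variables of the subterms are merged into one family, indexed by pairs of
   a subterm and one of its variables. *)
rewrite -[x]cfree_reprK.
elim: (cfree_repr x) => [v|m f ts IH].
  by exists 1%N, (sproj R ord0), (fun=> v); rewrite cop_proj.
(* The induction hypothesis is existential for each subterm separately; choice fixes an arity, a
   smooth function and variables for all subterms at once. *)
have /choice[F FP] : forall i, exists g : {n : nat & (smooth R n * ('I_n -> V))%type},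
    cfree_mk (ts i) = cop (tagged g).1 (fun j => cfree_var ((tagged g).2 j)).
  move=> i; have [n [g [v gv]]] := IH i.
  by exists (Tagged (fun n => (smooth R n * ('I_n -> V))%type) (g, v)).
pose J := {i : 'I_m & 'I_(tag (F i))}.
pose var i (j : 'I_(tag (F i))) : 'I_#|{: J}| :=
  enum_rank (Tagged (fun i => 'I_(tag (F i))) j).
exists #|{: J}|, (scomp f (fun i => scomp (tagged (F i)).1 (fun j => sproj R (var i j)))),
  (fun k => (tagged (F (tag (enum_val k)))).2 (tagged (enum_val k))).
rewrite cop_comp -cfree_op_mk; congr cop; apply/funext => i.
rewrite FP cop_comp; congr cop; apply/funext => j.
by rewrite cop_proj enum_rankK.
Qed.

(** * Construction, naturality and uniqueness of the deriving transformation *)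

Section Derivation.
Variables (R : realType) (L : functor (RVec R) (CinfCat R)).
Variable adj : adjunction L (forget R).

Local Notation eta V := (rapp (Sinf_eta adj V)).

(* The induced endomorphism L V -> cfree V -> L V is the identity, so the normal
   form is inherited from [cfree V]. *)
Lemma Sinf_normal (V : lmodType R) (x : L V) :
  exists n (f : smooth R n) (v : 'I_n -> V), x = cop f (fun i => eta V (v i)).
Proof.
(* Since [L] is an arbitrary left adjoint, terms are available only in [cfree V]. The two universal
   properties give maps in both directions that preserve the generators. *)
pose phi : @hom (CinfCat R) (cfree V) (L V) := cfree_lift (Sinf_eta adj V : {linear V -> L V}).
pose psi : @hom (CinfCat R) (L V) (cfree V) :=
  adj_transpose adj (cfree_eta V : hom (V : RVec R) (forget R (cfree V))).
have psiK : comp psi phi = idm _.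
  apply: (adj_ext (adj := adj)).
  rewrite fmap1 compm1 fmapM compA adj_transposeK.
  by apply: lin_eq => v; exact: cfree_lift_var.
have -> : x = (phi : cinfHom _ _) ((psi : cinfHom _ _) x).
  by rewrite -cinf_compE -[cinf_comp _ _]/(comp psi phi) psiK.
have [n [f [v ->]]] := cfree_normal ((psi : cinfHom _ _) x).
exists n, f, v; rewrite (chP (phi : cinfHom _ _)); congr cop.
by apply/funext => i; exact: cfree_lift_var.
Qed.

Definition tens_sqz (A : cinfRing R) (V : lmodType R) : cinfRing R :=
  sqz (@tens_act1 R A V) (@tens_actM R A V) (@tens_actD R A V) (@tens_actZ R A V).

Definition Sinf_d_pair (V : lmodType R) :
    hom (V : RVec R) (forget R (tens_sqz (L V) V)) :=
  sqz_pair (@tens_act1 R (L V) V) (@tens_actM R (L V) V) (@tens_actD R (L V) V)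
    (@tens_actZ R (L V) V)
    (Sinf_eta adj V : {linear V -> L V}) (mklin (proj2 (pure_bilin (L V) V) 1)).

Definition Sinf_d_hom (V : lmodType R) :
  @hom (CinfCat R) (L V) (tens_sqz (L V) V) := adj_transpose adj (Sinf_d_pair V).

Definition Sinf_d_lin (V : lmodType R) : {linear L V -> tens (L V) V} :=
  lin_comp (cinf_lin (Sinf_d_hom V : cinfHom _ _))
    (sqz_snd (@tens_act1 R (L V) V) (@tens_actM R (L V) V) (@tens_actD R (L V) V)
       (@tens_actZ R (L V) V)).

(** The first projection is a morphism of C^infinity-rings, so its composite with the extension is
    an endomorphism of [L V] that fixes the generators, hence the identity. *)
Lemma Sinf_d_homE (V : lmodType R) (x : L V) :
  (Sinf_d_hom V : cinfHom _ _) x = (x, Sinf_d_lin V x) :> tens_sqz (L V) V.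
Proof.
rewrite [LHS]surjective_pairing; congr pair.
pose p : @hom (CinfCat R) (tens_sqz (L V) V) (L V) := sqz_fst _ _ _ _.
suff dp : comp (Sinf_d_hom V) p = idm _.
  by rewrite -[LHS]/((comp (Sinf_d_hom V) p : cinfHom _ _) x) dp.
apply: (adj_ext (adj := adj)); rewrite fmap1 compm1 fmapM compA adj_transposeK.
exact: lin_eq.
Qed.

Lemma Sinf_d_eta (V : lmodType R) (v : V) : Sinf_d_lin V (eta V v) = pure (1 : L V) v.
Proof.
have := congr1 (fun h => rapp h v) (adj_transposeK adj (Sinf_d_pair V)).
exact: (congr1 snd).
Qed.

(** This is the second component of the statement that [Sinf_d_hom V] preserves the operation [f].
    The constant, Leibniz and chain axioms are all instances of it. *)
Lemma Sinf_d_cop (V : lmodType R) n (f : smooth R n) (a : 'I_n -> L V) :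
  Sinf_d_lin V (cop f a)
  = \sum_i tens_act V (cop (spartial i f) a) (Sinf_d_lin V (a i)).
Proof.
pose h : cinfHom (L V) (tens_sqz (L V) V) := Sinf_d_hom V.
have hE x : h x = (x, Sinf_d_lin V x) by exact: Sinf_d_homE.
have := chP h f a; rewrite hE.
rewrite (_ : (fun j => h (a j)) = fun j => (a j, Sinf_d_lin V (a j))).
  exact: (congr1 snd).
exact/funext.
Qed.

Lemma Sinf_d_cop_eta (V : lmodType R) n (f : smooth R n) (v : 'I_n -> V) :
  Sinf_d_lin V (cop f (fun i => eta V (v i)))
  = \sum_i pure (cop (spartial i f) (fun i => eta V (v i))) (v i).
Proof.
rewrite Sinf_d_cop; apply: eq_bigr => i _.
by rewrite Sinf_d_eta tens_act_pure mulr1.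
Qed.

Lemma Sinf_map_eta (V W : lmodType R) (h : {linear V -> W}) (v : V) :
  (fmap L (h : @hom (RVec R) V W) : cinfHom _ _) (eta V v) = eta W (h v).
Proof.
exact: esym (congr1 (fun k => rapp k v) (naturality (Sinf_eta adj) (h : @hom (RVec R) V W))).
Qed.

Lemma Sinf_map_cop_eta (V W : lmodType R) (h : {linear V -> W}) n
    (f : smooth R n) (v : 'I_n -> V) :
  (fmap L (h : @hom (RVec R) V W) : cinfHom _ _) (cop f (fun i => eta V (v i)))
  = cop f (fun i => eta W (h (v i))).
Proof.
rewrite [LHS]chP; congr cop; apply/funext => i; exact: Sinf_map_eta.
Qed.

(** On a normal form, both composites give the sum of the [(d_i f)(eta (h v_1), ..., eta (h v_n))
    \ox h v_i]. *)
Lemma Sinf_d_nat (V W : RVec R) (h : hom V W) :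
  comp (fmap (Sinf L) h) (Sinf_d_lin W)
  = comp (Sinf_d_lin V : hom (Sinf L V) (tensF (Sinf L) (idF (RVec R)) V))
      (fmap (tensF (Sinf L) (idF (RVec R))) h).
Proof.
apply: lin_eq => x; rewrite [LHS]rcompE [RHS]rcompE.
have [n [f [v ->]]] := Sinf_normal x.
rewrite [X in _ X = _]Sinf_map_cop_eta Sinf_d_cop_eta.
rewrite [X in _ = _ X]Sinf_d_cop_eta linear_sum; apply: eq_bigr => i _.
rewrite [RHS]tens_mapE; congr pure; exact: esym (Sinf_map_cop_eta _ _ _).
Qed.

Definition Sinf_d : nattrans (Sinf L) (tensF (Sinf L) (idF (RVec R))) :=
  @NatTrans _ _ (Sinf L) (tensF (Sinf L) (idF (RVec R))) Sinf_d_lin Sinf_d_nat.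

Lemma Sinf_d_formula : deriv_formula adj Sinf_d.
Proof. by move=> n f; exact: Sinf_d_cop_eta. Qed.

Lemma deriv_formula_uniq (d d' : nattrans (Sinf L) (tensF (Sinf L) (idF (RVec R)))) :
  deriv_formula adj d -> deriv_formula adj d' -> d = d'.
Proof.
move=> dP d'P.
suff E V : d V = d' V.
  case: d d' E {dP d'P} => [d dN] [d' dN'] /= E.
  have {}E : d = d' by exact: functional_extensionality_dep.
  by rewrite E in dN *; congr NatTrans; exact: Prop_irrelevance.
apply: lin_eq => x; have [n [f [v ->]]] := Sinf_normal x.
(* The linear map [h] from R^n to [V] sends [e_i] to [v i], so the normal form is the image under
   [fmap (Sinf L) h] of [f] in S(R^n). Naturality along [h] transports the formula from R^n to
   [V]. *)
have h_lin : linear (fun y : Rn R n => \sum_i y 0 i *: v i).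
  move=> k y z; rewrite scaler_sumr -big_split; apply: eq_bigr => i _ /=.
  by rewrite !mxE scalerDl scalerA.
pose h : {linear Rn R n -> V} := mklin h_lin.
have hE i : h (delta_mx 0 i : Rn R n) = v i.
  rewrite -[LHS]/(\sum_j _) (bigD1 i) //= big1 => [|j /negPf ji].
    by rewrite mxE !eqxx scale1r addr0.
  by rewrite mxE eqxx ji scale0r.
have -> : cop f (fun i => eta V (v i))
    = rapp (fmap (Sinf L) (h : @hom (RVec R) (Rn R n) V))
        (Sinf_of_smooth_fun adj f).
  rewrite [RHS]Sinf_map_cop_eta; congr cop.
  by apply/funext => i; rewrite hE.
have natE (e : nattrans (Sinf L) (tensF (Sinf L) (idF (RVec R)))) y :
    rapp (e V) (rapp (fmap (Sinf L) (h : @hom (RVec R) (Rn R n) V)) y)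
    = rapp (fmap (tensF (Sinf L) (idF (RVec R))) (h : @hom (RVec R) (Rn R n) V))
       (rapp (e (Rn R n)) y).
  exact: (congr1 (fun k => rapp k y) (naturality e (h : @hom (RVec R) (Rn R n) V))).
by rewrite -[LHS]/(rapp (d V) _) -[RHS]/(rapp (d' V) _) !natE dP d'P.
Qed.

End Derivation.

(** * The codifferential structure *)

Lemma adj_is_monad (C D : category) (L : functor C D) (U : functor D C)
  (adj : adjunction L U) : is_monad (adj_mu adj) (adj_eta adj).
Proof.
split=> a /=.
- exact: adj_triR.
- by rewrite -fmapM adj_triL fmap1.
- by rewrite -!fmapM; congr fmap; exact: esym (naturality (adj_counit adj) (adj_counit adj (L a))).
Qed.

Lemma alg_is_com_monoid (R : realType) (A : cinfRing R) :
  @is_com_monoid (RVec R) (forget R A) (alg_mul A) (alg_unit A).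
Proof.
have mulE (a b : A) : alg_mul A (pure a b) = a * b by exact: tens_liftE.
have unitE (k : R^o) : alg_unit A k = k *: (1 : A) by [].
split.
- apply: tens_ext3l => a b c; rewrite [LHS]rcompE [RHS]rcompE [X in _ = _ X]rcompE.
  rewrite [X in _ X = _]tens_mapE [X in _ = _ (_ X)]tens_assoE [X in _ = _ X]tens_mapE.
  by rewrite !mulE mulrA.
- apply: tens_ext => k a; rewrite [LHS]rcompE [X in _ X = _]tens_mapE mulE unitE.
  by rewrite -c_scaleAl mul1r [RHS]tens_lunitE.
- apply: tens_ext => a k; rewrite [LHS]rcompE [X in _ X = _]tens_mapE mulE unitE.
  by rewrite mulrC -c_scaleAl mul1r [RHS]tens_runitE.
- apply: tens_ext => a b; rewrite [LHS]rcompE [X in _ X = _]tens_symE !mulE.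
  exact: mulrC.
Qed.

(** Applied to the counit at [L V], whose underlying linear map is the multiplication of the
    monad. *)
Lemma cinf_lin_monoid_morphism (R : realType) (A B : cinfRing R) (f : cinfHom A B) :
  @is_monoid_morphism (RVec R) (forget R A) (forget R B)
    (alg_mul A) (alg_unit A) (alg_mul B) (alg_unit B) (cinf_lin f).
Proof.
split.
- apply: tens_ext => a b; rewrite [LHS]rcompE [RHS]rcompE.
  rewrite [X in _ X = _]tens_liftE [X in _ = _ X]tens_mapE [RHS]tens_liftE.
  exact: cinfHomM.
- apply: lin_eq => k; rewrite [LHS]rcompE.
  by have := cinfHom_cst f k; rewrite !c_cstE.
Qed.

(** * Verification of the deriving axioms *)

Section Deriving.
Variables (R : realType) (L : functor (RVec R) (CinfCat R)).
Variable adj : adjunction L (forget R).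
Implicit Types V : lmodType R.

Local Notation eta V := (rapp (Sinf_eta adj V)).

(** The structural composite ending the first Leibniz term and the chain rule is the module action
    on [L V \ox V], in which [Sinf_d_cop] is phrased. *)
Lemma assoV_mul_pure V (a : L V) (x : tens (L V) V) :
  ((assoV (Sinf L V) (Sinf L V) V >>> (Sinf_m L V \oxm idm (V : RVec R)))
    : {linear _ -> _}) (pure a x) = tens_act V a x.
Proof.
move: x; apply: tens_ind => [|x y IHx IHy|b v].
- by rewrite pure0r !linear0.
- by rewrite pureDr !linearD IHx IHy.
- rewrite [LHS]rcompE [X in _ X = _]tens_assoVE [LHS]tens_mapE tens_act_pure.
  by congr pure; exact: tens_liftE.
Qed.

(** The analogue for the second Leibniz term; here [b] multiplies from the right, so commutativity
    of [L V] turns it into the action. *)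
Lemma swap_mul_pure V (x : tens (L V) V) (b : L V) :
  ((asso (Sinf L V) V (Sinf L V) >>> (idm (Sinf L V) \oxm sym (V : RVec R) (Sinf L V))
     >>> assoV (Sinf L V) (Sinf L V) V >>> (Sinf_m L V \oxm idm (V : RVec R)))
    : {linear _ -> _}) (pure x b) = tens_act V b x.
Proof.
move: x; apply: tens_ind => [|x y IHx IHy|c v].
- by rewrite pure0l !linear0.
- by rewrite pureDl !linearD IHx IHy.
- transitivity (tens_map (alg_mul (L V)) (lin_id V) (tens_assoV (L V) (L V) V
      (tens_map (lin_id (L V)) (tens_sym V (L V))
        (tens_asso (L V) V (L V) (pure (pure c v) b))))); first by [].
  rewrite tens_assoE tens_mapE tens_symE tens_assoVE tens_mapE tens_act_pure mulrC.
  by congr pure; exact: tens_liftE.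
Qed.

Lemma asso_sym_assoV_pure (A V W : lmodType R) (a : A) (v : V) (w : W) :
  ((asso (A : RVec R) V W >>> (idm (A : RVec R) \oxm sym (V : RVec R) W)
     >>> assoV (A : RVec R) W V) : {linear _ -> _}) (pure (pure a v) w)
  = pure (pure a w) v.
Proof.
transitivity (tens_assoV A W V (tens_map (lin_id A) (tens_sym V W)
  (tens_asso A V W (pure (pure a v) w)))); first by [].
by rewrite tens_assoE tens_mapE tens_symE tens_assoVE.
Qed.

(** The counit preserves the operation [f], and a triangle identity cancels it against each [eta]:
    [mu] evaluates formal variables. *)
Lemma Sinf_mu_cop_eta V n (f : smooth R n) (a : 'I_n -> L V) :
  rapp (Sinf_mu adj V) (cop f (fun i => eta (L V : lmodType R) (a i))) = cop f a.
Proof.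
rewrite [LHS](chP (adj_counit adj (L V) : cinfHom _ _)); congr cop.
apply/funext => i.
exact: (congr1 (fun h => rapp h (a i)) (adj_triR adj (L V))).
Qed.

(** In this form, exchanging the two factors [V] amounts to exchanging [i] and [j], which reduces
    the last axiom to [spartialC]. *)
Lemma Sinf_d2_cop_eta V n (f : smooth R n) (v : 'I_n -> V) :
  ((Sinf_d adj V >>> (Sinf_d adj V \oxm idm (V : RVec R))) : {linear _ -> _})
    (cop f (fun i => eta V (v i)))
  = \sum_i \sum_j pure (pure (cop (spartial j (spartial i f)) (fun i => eta V (v i)))
                           (v j)) (v i).
Proof.
rewrite [LHS]rcompE [X in _ X = _]Sinf_d_cop_eta linear_sum.
apply: eq_bigr => i _; rewrite [LHS]tens_mapE [X in pure X _ = _]Sinf_d_cop_eta.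
exact: (linear_sum (mklin (proj1 (pure_bilin _ _) (v i)))).
Qed.

Lemma Sinf_d_mul V (a b : L V) :
  Sinf_d_lin adj V (a * b)
  = tens_act V a (Sinf_d_lin adj V b) + tens_act V b (Sinf_d_lin adj V a).
Proof.
have addE (x y : L V) : c_add x y = x + y by [].
have mulE (x y : L V) : c_mul x y = x * y by [].
(* The product is the operation [x0 * x1], whose partial derivatives are [x1] and [x0]. *)
rewrite -[a * b]/(cop _ _) Sinf_d_cop !big_ord_recl big_ord0 addr0 addrC.
rewrite !spartial_smul !spartial_sproj !cop_add !cop_mul !cop_proj !cop_cst.
rewrite /= !addE !mulE !c_cstE /ar2 !(tnth_nth 0) /=.
by rewrite !scale1r !scale0r !mulr0 !mulr1 add0r addr0.
Qed.

Lemma Sinf_is_deriving :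
  is_deriving (Sinf_mu adj) (Sinf_eta adj) (Sinf_m L) (Sinf_u L) (Sinf_d adj).
Proof.
split=> V.
- apply: lin_eq => k; rewrite [LHS]rcompE.
  transitivity (Sinf_d_lin adj V (k *: (1 : L V))); first by [].
  (* The unit is an operation of arity 0, so its derivative is an empty sum. *)
  rewrite linearZ -[1 : L V]/(cop (scst 0 1) (ar0 (L V))) Sinf_d_cop big_ord0.
  exact: scaler0.
- apply: tens_ext => a b; rewrite [LHS]rcompE.
  rewrite [X in _ X = _]tens_liftE [LHS]Sinf_d_mul [RHS]lin_addE.
  congr (_ + _).
    rewrite -compA [RHS]rcompE [X in _ = _ X]tens_mapE.
    exact: esym (assoV_mul_pure _ _).
  transitivity (tens_act V b (Sinf_d_lin adj V a)); first by [].
  rewrite -!compA [RHS]rcompE [X in _ = _ X]tens_mapE !compA.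
  exact: esym (swap_mul_pure _ _).
- apply: lin_eq => v; rewrite [LHS]rcompE [LHS]Sinf_d_eta [RHS]rcompE.
  by rewrite [RHS]tens_mapE; congr pure; rewrite [RHS]scale1r.
- apply: lin_eq => x; rewrite -!compA [LHS]rcompE.
  (* With [x = f (eta a_1, ..., eta a_n)] and the [a_i] in S(V), both sides become the sum of
     [(d_i f)(a_1, ..., a_n)] acting on [d a_i]. *)
  have [n [f [a ->]]] := Sinf_normal adj x.
  rewrite [X in _ X = _]Sinf_mu_cop_eta [LHS]Sinf_d_cop.
  set y := cop f _.
  transitivity (((assoV (Sinf L V) (Sinf L V) V >>> (Sinf_m L V \oxm idm (V : RVec R)))
    : {linear _ -> _})
      (tens_map (Sinf_mu adj V) (Sinf_d_lin adj V) (Sinf_d_lin adj (L V) y))); last by [].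
  rewrite Sinf_d_cop_eta (linear_sum (tens_map _ _)) linear_sum; apply: eq_bigr => i _.
  rewrite tens_mapE [X in pure X _]Sinf_mu_cop_eta.
  exact: esym (assoV_mul_pure _ _).
- apply: lin_eq => x; have [n [f [v ->]]] := Sinf_normal adj x.
  rewrite [LHS]Sinf_d2_cop_eta -!compA 2!compA.
  (* Exchanging the double sum on the right pairs the terms with equal tensor factors, leaving only
     the order of the partial derivatives to compare. *)
  rewrite [RHS]rcompE [X in _ = _ X]Sinf_d2_cop_eta linear_sum exchange_big.
  apply: eq_bigr => i _; rewrite linear_sum; apply: eq_bigr => j _.
  by rewrite spartialC [RHS]asso_sym_assoV_pure.
Qed.

End Deriving.

Theorem theorem5p14 (R : realType) (L : functor (RVec R) (CinfCat R))
    (adj : adjunction L (forget R)) :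
  exists2 d : nattrans (Sinf L) (tensF (Sinf L) (idF (RVec R))),
    unique (deriv_formula adj) d &
    is_codifferential (Sinf_mu adj) (Sinf_eta adj) (Sinf_m L) (Sinf_u L) d.
Proof.
exists (Sinf_d adj).
  split; first exact: Sinf_d_formula.
  by move=> d'; exact: deriv_formula_uniq (Sinf_d_formula adj).
split; last exact: Sinf_is_deriving.
split; first exact: adj_is_monad.
- by move=> V; exact: alg_is_com_monoid.
- by move=> V; exact: cinf_lin_monoid_morphism.
Qed.
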